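(* Let $n\in\mathbb{N}$, $n>0$, and let $\mathcal{H}_n=\{u\in H^n(S^1): u_x\not\equiv 0 \text{ a.e.}\}$ (i.e. the non-constant functions in $H^n(S^1)$). Then $$\inf_{u\in\mathcal{H}_n}\frac{\int_{S^1}\left|u^{(n)}\right|^2dx}{\int_{S^1}u^2\log\left(u^2/\|u\|_{L^2(S^1)}^2\right)dx}=\frac12\left(\frac{2\pi}{L}\right)^{2n}.$$
   Context: $L>0$ is fixed and $S^1$ is the one-dimensional torus parametrized by $x\in[0,L]$; $H^n(S^1)$ is the Sobolev space of real-valued $L$-periodic functions, and $u^{(n)}$ is the $n$-th (weak) derivative of $u$. The norm $\|\cdot\|_{L^2(S^1)}$ is normalized: $\|u\|_{L^2(S^1)}^2=\frac1L\int_{S^1}u^2\,dx$, while the integrals $\int_{S^1}\cdot\,dx$ are with respect to the (unnormalized) Lebesgue measure on $[0,L]$. Convention: $0\log 0=0$. *)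

(* Defs.v *)
From HB Require Import structures.
From mathcomp Require Import all_boot all_order all_algebra.
From mathcomp Require Import all_classical all_reals all_analysis.
Set Implicit Arguments.
Unset Strict Implicit.
Unset Printing Implicit Defensive.
Import Order.TTheory GRing.Theory Num.Theory.
Import numFieldNormedType.Exports.
Local Open Scope classical_set_scope.
Local Open Scope ring_scope.

(* A function on the circle of length L is an L-periodic function on the line,
   integrated over one period; equivalence classes modulo a.e. equality are
   handled through representatives. *)
Definition circle_int (R : realType) (L : R) (f : R -> R) : R :=
  \int[@lebesgue_measure R]_(x in `[0, L]) f x.

Definition circle_Lp (R : realType) (L : R) (p : nat) (f : R -> R) : Prop :=
  [/\ periodic f L, measurable_fun [set: R] f &
      (@lebesgue_measure R).-integrable `[0, L] (fun x => (`|f x| ^+ p)%:E)].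

(* Smooth functions on the circle: they are the test functions, and no boundary
   condition is needed since the circle has no boundary. *)
Definition circle_test (R : realType) (L : R) (phi : R -> R) : Prop :=
  periodic phi L /\ forall (k : nat) (x : R), derivable (derive1n k phi) x 1.

Definition is_weak_deriv (R : realType) (L : R) (k : nat) (u v : R -> R) : Prop :=
  circle_Lp L 1 v /\
  forall phi : R -> R, circle_test L phi ->
    circle_int L (fun x => u x * derive1n k phi x) =
    (- 1) ^+ k * circle_int L (fun x => v x * phi x).

(* A representative of the k-th weak derivative, which is unique up to a.e.
   equality when it exists; 0 if there is none. *)
Definition weak_deriv (R : realType) (L : R) (k : nat) (u : R -> R) : R -> R :=
  xget (fun=> 0) [set v | is_weak_deriv L k u v].

Definition sobolev (R : realType) (L : R) (n : nat) (u : R -> R) : Prop :=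
  circle_Lp L 2 u /\
  forall k : nat, (k <= n)%N ->
    exists2 v : R -> R, is_weak_deriv L k u v & circle_Lp L 2 v.

Definition calH (R : realType) (L : R) (n : nat) : set (R -> R) :=
  [set u | sobolev L n u /\
    ~ (\forall x \ae @lebesgue_measure R, x \in `[0, L] -> weak_deriv L 1 u x = 0)].

Definition circle_L2norm (R : realType) (L : R) (u : R -> R) : R :=
  Num.sqrt (L^-1 * circle_int L (fun x => u x ^+ 2)).

(* [ln 0 = 0], so the integrand vanishes where u does. *)
Definition entropy (R : realType) (L : R) (u : R -> R) : R :=
  circle_int L (fun x => u x ^+ 2 * ln (u x ^+ 2 / circle_L2norm L u ^+ 2)).

Definition energy (R : realType) (L : R) (n : nat) (u : R -> R) : R :=
  circle_int L (fun x => `|weak_deriv L n u x| ^+ 2).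

(* Main.v *)
Require Import Defs.
From HB Require Import structures.
From mathcomp Require Import all_boot all_order all_algebra.
From mathcomp Require Import all_classical all_reals all_analysis.
From mathcomp Require Import measurable_realfun ring lra.
Set Implicit Arguments.
Unset Strict Implicit.
Unset Printing Implicit Defensive.
Import Order.TTheory GRing.Theory Num.Theory.
Import numFieldNormedType.Exports.
Local Open Scope classical_set_scope.
Local Open Scope ring_scope.

(* For n = 1 we use a calibration. With [w = 2 pi / L] and
   [well v = (v^2 ln v^2 - v^2 + 1) / 2], rescale u so that min |u| and max |u|
   lie on one level {well = E}. Integrating
     u'^2 + w^2 (E - well u) >= 2 w |u'| sqrt (E - well u)
   and using that |u| runs at least twice between its extremes, one is reduced to
     2 * (integral of sqrt (E - well) between the extremes) >= pi E.
   This follows by substituting [y = sgn (v - 1) sqrt (well v)], since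
   [dv/dy >= 1 - y / 3] and the odd term drops out by symmetry. The result is
   [integral of u'^2 >= w^2 * integral of well u], and twice the last integral
   exceeds the entropy of u by L (r ln r - r + 1) >= 0, where r is the mean of u^2.
   Linearising at 1 gives the Poincare inequality, which is iterated on the
   derivatives for larger n. The perturbations 1 + e cos (w x) show sharpness.
   A weak derivative in L^1 makes u absolutely continuous up to a null set; all
   chain rules are replaced by the increment bound
   |u t - u s| <= integral of |u'| and a Cousin-type argument. *)

(** Critical points for n = 1, once normalized, solve u'' = - w^2 u ln u, an oscillator with first
    integral u'^2 + w^2 well u = w^2 E; the calibration inequality is an equality along its orbits.
    Near 1 the well osculates the parabola (v - 1)^2, whose orbits have period L and whose action,
    twice the integral of sqrt (E - (v - 1)^2), is the disc area pi E. The key estimate thus says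
    that the true well has at least the action of its parabola; the constant is reached only in the
    limit of small amplitude along the perturbations of 1. The slope -1/3 comes from well (1 + s) =
    s^2 + s^3 / 3 + ..., hence y = s + s^2 / 6 + ... and dv/dy = 1 - y / 3 + ...: the bound is the
    tangent line at y = 0. Rescaling is free because entropy and energy are homogeneous of degree
    two. A common level for both extremes makes E - well u nonnegative and the range of |u| a full
    swing of one orbit. Working with |u| caps E by well 0 = 1/2, so |y| < 1 at interior points and 1
    - y / 3 stays positive. The calibrating primitive is singular at 1 (square root of the well) and
    at both extremes (arcsine), so it too is used only through its increments. *)

(** * Integrals over segments, and gluing of local bounds *)

Section interval_integral.
Context {R : realType}.
Implicit Types (a b c d x y : R) (f g h : R -> R).
Local Notation mu := (@lebesgue_measure R).

Definition integ_on a b f := mu.-integrable `[a, b] (EFin \o f).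
(** [circle_int L] is convertible with [Rint 0 L], so the circle and its arcs share one set of
    lemmas. For [b < a] the domain is empty and the value is 0, not the opposite of the reversed
    integral. *)
Definition Rint a b f := \int[mu]_(x in `[a, b]) f x.

Lemma integ_measurable a b f : integ_on a b f -> measurable_fun `[a, b] f.
Proof. by move=> /integrableP[/measurable_EFinP]. Qed.

Lemma within_cont a b f : continuous f -> {within `[a, b], continuous f}.
Proof. by move=> cf; apply: continuous_subspaceT. Qed.

Lemma integ_cont a b f : {within `[a, b], continuous f} -> integ_on a b f.
Proof.
by move=> cf; apply: continuous_compact_integrable => //; exact: segment_compact.
Qed.

Lemma integ_cst a b c : integ_on a b (cst c).
Proof. by apply: integ_cont; apply: within_cont => x; exact: cvg_cst. Qed.

Lemma integ_sub a b c d f : a <= c -> d <= b -> integ_on a b f -> integ_on c d f.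
Proof.
move=> ac db; apply: integrableS => //.
by apply: subset_itvScc; rewrite bnd_simp.
Qed.

Lemma integD a b f g :
  integ_on a b f -> integ_on a b g -> integ_on a b (fun x => f x + g x).
Proof. by move=> fi gi; exact: (@integrableD _ _ _ mu `[a, b] _ (EFin \o f) (EFin \o g)). Qed.

Lemma integB a b f g :
  integ_on a b f -> integ_on a b g -> integ_on a b (fun x => f x - g x).
Proof. by move=> fi gi; exact: (@integrableB _ _ _ mu `[a, b] _ (EFin \o f) (EFin \o g)). Qed.

Lemma integZ a b c f : integ_on a b f -> integ_on a b (fun x => c * f x).
Proof. by move=> fi; exact: (@integrableZl _ _ _ mu `[a, b] _ c (EFin \o f)). Qed.

Lemma integ_norm a b f : integ_on a b f -> integ_on a b (fun x => `|f x|).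
Proof. exact: integrable_norm. Qed.

Lemma integ_bM a b f g c : measurable_fun `[a, b] f ->
  (forall x, a <= x <= b -> `|f x| <= c) -> integ_on a b g ->
  integ_on a b (fun x => f x * g x).
Proof.
move=> mf fc gi; apply: (@integrableMr _ _ _ mu `[a, b] _ f (EFin \o g)) => //.
exists c; split; first exact: num_real.
move=> M cM x /=; rewrite in_itv/= => /fc; move/le_trans; apply; exact: ltW.
Qed.

Lemma integ_contM a b f g : {within `[a, b], continuous f} -> integ_on a b g ->
  integ_on a b (fun x => f x * g x).
Proof.
move=> cf gi.
have /compact_bounded[M [_ Mf]] := continuous_compact cf (@segment_compact _ a b).
apply: (@integ_bM _ _ _ _ (M + 1)) => //.
  by apply: subspace_continuous_measurable_fun.
move=> x xab; apply: (Mf (M + 1)); first by rewrite ltrDl.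
by exists x => //=; rewrite in_itv.
Qed.

Lemma integ_le a b f g : measurable_fun `[a, b] f ->
  (forall x, a <= x <= b -> `|f x| <= g x) -> integ_on a b g -> integ_on a b f.
Proof.
move=> mf fg; apply: le_integrable => //; first exact/measurable_EFinP.
move=> x /=; rewrite in_itv/= lee_fin => /fg /le_trans; apply; exact: ler_norm.
Qed.

Lemma integ_sqr_norm a b f : measurable_fun `[a, b] f ->
  integ_on a b (fun x => f x ^+ 2) -> integ_on a b f.
Proof.
move=> mf f2; apply: (@integ_le _ _ _ (fun x => 1 + f x ^+ 2)) => //.
  move=> x _; rewrite -real_normK ?num_real//; nra.
by apply: integD => //; exact: integ_cst.
Qed.

Lemma RintD a b f g : integ_on a b f -> integ_on a b g ->
  Rint a b (fun x => f x + g x) = Rint a b f + Rint a b g.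
Proof. by move=> fi gi; exact: RintegralD. Qed.

Lemma RintB a b f g : integ_on a b f -> integ_on a b g ->
  Rint a b (fun x => f x - g x) = Rint a b f - Rint a b g.
Proof. by move=> fi gi; exact: RintegralB. Qed.

Lemma RintZ a b c f : integ_on a b f ->
  Rint a b (fun x => c * f x) = c * Rint a b f.
Proof. by move=> fi; exact: RintegralZl. Qed.

Lemma Rint_cst a b c : a <= b -> Rint a b (cst c) = c * (b - a).
Proof.
move=> ab; rewrite /Rint Rintegral_cst//= lebesgue_measure_itv/= lte_fin.
move: ab; rewrite le_eqVlt => /predU1P[->|->//]; first by rewrite ltxx/= subrr.
Qed.

Lemma Rint_eq a b f g : (forall x, a <= x <= b -> f x = g x) ->
  Rint a b f = Rint a b g.
Proof.
by move=> fg; apply: eq_Rintegral => x; rewrite inE/= in_itv/= => /fg.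
Qed.

Lemma integ_eq a b f g : (forall x, a <= x <= b -> f x = g x) ->
  integ_on a b f -> integ_on a b g.
Proof.
move=> fg; apply: eq_integrable => // x; rewrite inE/= in_itv/= => /fg.
by rewrite /comp => ->.
Qed.

Lemma le_Rint a b f g : integ_on a b f -> integ_on a b g ->
  (forall x, a <= x <= b -> f x <= g x) -> Rint a b f <= Rint a b g.
Proof.
by move=> fi gi fg; apply: le_Rintegral => // x /=; rewrite in_itv/= => /fg.
Qed.

Lemma Rint_ge0 a b f : (forall x, a <= x <= b -> 0 <= f x) -> 0 <= Rint a b f.
Proof. by move=> f0; apply: Rintegral_ge0 => x /=; rewrite in_itv/= => /f0. Qed.

Lemma le_norm_Rint a b f : integ_on a b f ->
  `|Rint a b f| <= Rint a b (fun x => `|f x|).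
Proof. by move=> fi; exact: le_normr_Rintegral. Qed.

Lemma Rint_split a b c f : a <= c <= b -> integ_on a b f ->
  Rint a b f = Rint a c f + Rint c b f.
Proof.
move=> /andP[ac cb] fi; apply/eqP; rewrite addrC -subr_eq; apply/eqP.
rewrite /Rint (@Rintegral_itvB _ _ (BLeft a) (BRight b))//.
rewrite Rintegral_itv_obnd_cbnd//.
apply: integrableS fi => //; apply: subset_itv; by rewrite bnd_simp.
Qed.

Lemma Rintxx a f : Rint a a f = 0.
Proof. by rewrite /Rint set_itv1 Rintegral_set1. Qed.

Lemma ae_mono (P Q : R -> Prop) : (forall x, P x -> Q x) ->
  {ae mu, forall x, P x} -> {ae mu, forall x, Q x}.
Proof. by apply: filterS; exact: (ae_filter_ringOfSetsType mu). Qed.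

Lemma ae_mono2 (P Q S : R -> Prop) : (forall x, P x -> Q x -> S x) ->
  {ae mu, forall x, P x} -> {ae mu, forall x, Q x} -> {ae mu, forall x, S x}.
Proof. by apply: filterS2; exact: (ae_filter_ringOfSetsType mu). Qed.

Definition ae_eq_on a b f g := {ae mu, forall x, a <= x <= b -> f x = g x}.

Lemma Rint_ae a b f g : measurable_fun `[a, b] f -> measurable_fun `[a, b] g ->
  ae_eq_on a b f g -> Rint a b f = Rint a b g.
Proof.
move=> mf mg fg; rewrite /Rint /Rintegral; congr fine.
apply: ae_eq_integral => //; [exact/measurable_EFinP|exact/measurable_EFinP|].
by apply: ae_mono fg => x /= + xab; rewrite in_itv/= in xab => /(_ xab) ->.
Qed.

Lemma integ_ae a b f g : measurable_fun `[a, b] g ->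
  ae_eq_on a b f g -> integ_on a b f -> integ_on a b g.
Proof.
move=> mg fg /integrableP[mf fi]; apply/integrableP; split.
  exact/measurable_EFinP.
rewrite -(@ae_eq_integral _ _ _ mu `[a, b] (abse \o (EFin \o g)) (abse \o (EFin \o f)))//.
- exact: measurableT_comp.
- by apply: measurableT_comp => //; exact/measurable_EFinP.
- by apply: ae_mono fg => x /= + xab; rewrite in_itv/= in xab => /(_ xab) ->.
Qed.

(** At the supremum c of the points t with [H a <= H t], the local condition compares a point just
    before c with one just after, which carries the inequality past c. Only pairs straddling x are
    compared, so continuity estimates at the single point x suffice to verify the condition. *)
Lemma cousin_le (H : R -> R) a b : a <= b ->
  (forall x, a <= x <= b -> exists2 e, 0 < e &
    forall s t, a <= s <= x -> x <= t <= b -> x - s < e -> t - x < e ->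
    H s <= H t) ->
  H a <= H b.
Proof.
move=> ab loc.
pose S := [set t | a <= t <= b /\ H a <= H t].
have Sa : S a by split; rewrite ?lexx ?ab.
have Sub : ubound S b by move=> t [/andP[]].
have hS : has_sup S by split; [exists a|exists b].
pose c := sup S.
have ac : a <= c by apply: ub_le_sup => //; exists b.
have cb : c <= b by apply: ge_sup => //; exists a.
have [e e0 He] := loc c (introT andP (conj ac cb)).
have [s [/andP[as_ sb] Hs] cs] := @sup_adherent _ S e e0 hS.
have sc : s <= c by apply: ub_le_sup; [exists b|split => //; apply/andP].
have Ht t : c <= t <= b -> t - c < e -> H a <= H t.
  move=> ctb te; apply: le_trans Hs _; apply: He => //.
  - by rewrite as_.
  - by rewrite ltrBlDr addrC -ltrBlDr.
have [cE|cneb] := eqVneq c b.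
  by rewrite -cE; apply: Ht; rewrite ?lexx ?cb ?subrr.
have {cneb} cltb : c < b by rewrite lt_neqAle cneb.
pose t := Num.min b (c + e / 2).
have tb : t <= b by rewrite ge_min lexx.
have ct : c < t by rewrite lt_min cltb ltrDl divr_gt0.
have te : t - c < e.
  have : t <= c + e / 2 by rewrite ge_min lexx orbT.
  lra.
have St : S t.
  split; first by rewrite tb (le_trans ac (ltW ct)).
  by apply: Ht => //; rewrite (ltW ct).
have : t <= c by apply: ub_le_sup => //; exists b.
lra.
Qed.

Lemma Rint_continuous a b f : a <= b -> integ_on a b f ->
  {within `[a, b], continuous (Rint a ^~ f)}.
Proof. exact: parameterized_integral_continuous. Qed.

Lemma within_contP a b f : {within `[a, b], continuous f} ->
  forall x, a <= x <= b -> forall e, 0 < e ->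
  exists2 r, 0 < r & forall y, a <= y <= b -> `|y - x| < r -> `|f y - f x| < e.
Proof.
move=> /subspace_continuousP cf x xab e e0.
have /cf/cvgrPdist_lt/(_ e e0) : [set` `[a, b]] x by rewrite /= in_itv.
move=> /nbhs_ballP[r /= r0 rP]; exists r => // y yab yx.
rewrite distrC; apply: rP; first by rewrite /ball/= distrC.
by rewrite /= in_itv.
Qed.

End interval_integral.

(** * Integration by parts against an indefinite integral *)

Section parts.
Context {R : realType}.
Implicit Types (a b c d x y : R) (f g h : R -> R).
Local Notation mu := (@lebesgue_measure R).

(** An increment version of the vanishing-derivative criterion: both [e * G + H] and [e * G - H] are
    nondecreasing for every e > 0. With G an integral, this serves functions that are differentiable
    only almost everywhere. *)
Lemma cousin_eq (H G : R -> R) a b : a <= b ->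
  (forall e, 0 < e -> forall x, a <= x <= b -> exists2 r, 0 < r &
    forall s t, a <= s <= x -> x <= t <= b -> x - s < r -> t - x < r ->
    `|H t - H s| <= e * (G t - G s)) ->
  H a = H b.
Proof.
move=> ab loc.
have key e : 0 < e -> `|H b - H a| <= e * (G b - G a).
  move=> e0.
  have p1 : e * G a + H a <= e * G b + H b.
    apply: (@cousin_le R (fun x => e * G x + H x)) => // x xab.
    have [r r0 rP] := loc e e0 x xab; exists r => // s t s1 t1 s2 t2.
    by have := rP s t s1 t1 s2 t2; rewrite ler_norml; lra.
  have p2 : e * G a - H a <= e * G b - H b.
    apply: (@cousin_le R (fun x => e * G x - H x)) => // x xab.
    have [r r0 rP] := loc e e0 x xab; exists r => // s t s1 t1 s2 t2.
    by have := rP s t s1 t1 s2 t2; rewrite ler_norml; lra.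
  by rewrite ler_norml; lra.
apply/eqP; rewrite eq_sym -subr_eq0 -normr_le0 leNgt; apply/negP => H0.
have := key 1 ltr01; rewrite mul1r => /(lt_le_trans H0) G0.
(* With this e the bound is half of the quantity it bounds; the case e = 1 has shown that the
   denominator is positive. *)
have := key (`|H b - H a| / (2 * (G b - G a))).
rewrite divr_gt0 ?mulr_gt0// => /(_ isT).
have -> : `|H b - H a| / (2 * (G b - G a)) * (G b - G a) = `|H b - H a| / 2.
  by field; rewrite gt_eqF.
lra.
Qed.

Lemma Rint_sub a b c f : a <= b -> b <= c -> integ_on a c f ->
  Rint a c f - Rint a b f = Rint b c f.
Proof.
by move=> ab bc fi; rewrite (@Rint_split _ a c b) ?ab// addrAC subrr add0r.
Qed.

Lemma within_contM a b f g : {within `[a, b], continuous f} ->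
  {within `[a, b], continuous g} -> {within `[a, b], continuous (fun x => f x * g x)}.
Proof. by move=> cf cg x; apply: continuousM; [exact: cf|exact: cg]. Qed.

(** The indefinite integral V of [v] has no pointwise derivative, so there is no product rule to
    integrate. Instead V phi minus the integral of [v phi + V dphi] is constant by [cousin_eq], with
    the integral of [|v| + |dphi|] as control. *)
Lemma Rint_parts a b v phi dphi : a <= b -> integ_on a b v ->
  (forall x, is_derive x 1 phi (dphi x)) -> continuous dphi ->
  Rint a b (fun x => Rint a x v * dphi x) =
  Rint a b v * phi b - Rint a b (fun x => v x * phi x).
Proof.
move=> ab vi dP cd.
have cphi : continuous phi.
  by move=> x; apply/differentiable_continuous/derivable1_diffP; have [] := dP x.
pose V x := Rint a x v.
have cV : {within `[a, b], continuous V} by exact: Rint_continuous.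
have i1 : integ_on a b (fun x => v x * phi x).
  apply: (@integ_eq _ _ _ (fun x => phi x * v x)) => [x _|]; first exact: mulrC.
  by apply: integ_contM vi; exact: within_cont.
have i2 : integ_on a b (fun x => V x * dphi x).
  by apply: integ_contM => //; apply: integ_cont; exact: within_cont.
pose h x := v x * phi x + V x * dphi x.
have hi : integ_on a b h by exact: integD.
pose g x := `|v x| + `|dphi x|.
have di : integ_on a b (fun x => `|dphi x|).
  by apply: integ_norm; apply: integ_cont; exact: within_cont.
have gi : integ_on a b g by apply: integD => //; exact: integ_norm.
suff /esym : V a * phi a - Rint a a h = V b * phi b - Rint a b h.
  by rewrite /V !Rintxx /h RintD//; lra.
apply: (@cousin_eq (fun x => V x * phi x - Rint a x h) (fun x => Rint a x g)) => //.
move=> e e0 x xab.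
have e20 : 0 < e / 2 by rewrite divr_gt0.
have [r1 r10 H1] := within_contP cV xab e20.
have [r2 r20 H2] := within_contP (within_cont cphi) xab e20.
exists (Num.min r1 r2); first by rewrite lt_min r10.
move=> s t sx xt sr tr.
have st : s <= t by lra.
have si : forall f, integ_on a b f -> integ_on s t f.
  by move=> f; apply: integ_sub; lra.
have dV : V t - V s = Rint s t v.
  by apply: Rint_sub => //; [lra|apply: integ_sub vi; lra].
have dphiE : phi t - phi s = Rint s t dphi.
  move: st; rewrite le_eqVlt => /predU1P[->|st]; first by rewrite Rintxx subrr.
  rewrite /Rint /Rintegral (@continuous_FTC2 _ _ phi)//.
  - exact: within_cont.
  - split; first by move=> y _; have [] := dP y.
    + by apply: cvg_at_right_filter; exact: cphi.
    + by apply: cvg_at_left_filter; exact: cphi.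
  - by move=> y _; rewrite derive1E; have [] := dP y.
rewrite !Rint_sub//; [|lra|by apply: integ_sub gi; lra].
have -> : V t * phi t - Rint a t h - (V s * phi s - Rint a s h) =
  (V t - V s) * phi t + V s * (phi t - phi s) - (Rint a t h - Rint a s h) by lra.
rewrite Rint_sub//; [|lra|by apply: integ_sub hi; lra].
rewrite dV dphiE.
have i3 : integ_on s t v by exact: si.
have i4 : integ_on s t dphi by apply: integ_cont; exact: within_cont.
rewrite mulrC -RintZ// -[V s * _]RintZ// -RintD ?integZ// -RintB//; last 2 first.
  by apply: integD; exact: integZ.
  exact: si.
apply: le_trans (le_norm_Rint _) _.
  by apply: integB; [apply: integD; exact: integZ|exact: si].
rewrite -RintZ; last exact: si.
apply: le_Rint; [|by apply: integZ; exact: si|].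
  by apply: integ_norm; apply: integB; [apply: integD; exact: integZ|exact: si].
move=> y yst.
(* Freezing [phi] at t and V at s leaves an error whose two coefficients are at most e, since all
   values involved lie within e / 2 of those at x. *)
have -> : phi t * v y + V s * dphi y - h y = (phi t - phi y) * v y + (V s - V y) * dphi y.
  by rewrite /h; lra.
rewrite /g mulrDr.
move: sr tr; rewrite !lt_min => /andP[sr1 sr2] /andP[tr1 tr2].
have dn z r : s <= z <= t -> x - s < r -> t - x < r -> `|z - x| < r.
  by move=> ? ? ?; rewrite ltr_norml; lra.
have P1 z : s <= z <= t -> `|phi z - phi x| < e / 2.
  by move=> zst; apply: H2; [lra|exact: dn].
have P2 z : s <= z <= t -> `|V z - V x| < e / 2.
  by move=> zst; apply: H1; [lra|exact: dn].
apply: le_trans (ler_normD _ _) _; rewrite !normrM; apply: lerD.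
  apply: ler_wpM2r => //; have := P1 t; have := P1 y; rewrite yst lexx st.
  by move=> /(_ isT) + /(_ isT); rewrite ler_norml !ltr_norml; lra.
apply: ler_wpM2r => //; have := P2 s; have := P2 y; rewrite yst lexx st.
by move=> /(_ isT) + /(_ isT); rewrite ler_norml !ltr_norml; lra.
Qed.

End parts.

(** * Smooth periodic test functions *)

Section smooth_functions.
Context {R : realType}.
Implicit Types (a b c x y L : R) (f g h phi psi : R -> R) (k : nat).
Local Notation mu := (@lebesgue_measure R).

Definition smooth f := forall k x, derivable (derive1n k f) x 1.

(** A class closed under differentiation: smoothness to all orders then takes one induction, without
    higher Leibniz or chain formulas. Its constructors are what the bumps and the cosine
    perturbations require. *)
Inductive elementary : (R -> R) -> Prop :=
| elem_cst c : elementary (fun=> c)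
| elem_sin a b : elementary (fun x => sin (a * x + b))
| elem_cos a b : elementary (fun x => cos (a * x + b))
| elem_add f g : elementary f -> elementary g -> elementary (fun x => f x + g x)
| elem_mul f g : elementary f -> elementary g -> elementary (fun x => f x * g x)
| elem_exp f : elementary f -> elementary (fun x => expR (f x)).

Lemma is_derive_affine a b x : is_derive x 1 (fun x => a * x + b) a.
Proof.
have : is_derive x 1 (a *: (id : R -> R) + cst b) (a *: 1 + 0) by exact: _.
by rewrite addr0 /GRing.scale/= mulr1.
Qed.

Lemma is_derive1_eq f x d d' : d = d' -> is_derive x 1 f d -> is_derive x 1 f d'.
Proof. by move=> ->. Qed.

Lemma elementary_derive f : elementary f ->
  exists2 g, elementary g & forall x, is_derive x 1 f (g x).
Proof.
elim=> {f} [c|a b|a b|f g ef [df edf fP] eg [dg edg gP]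
  |f g ef [df edf fP] eg [dg edg gP]|f ef [df edf fP]].
- by exists (fun=> 0) => [|x]; [exact: elem_cst|exact: is_derive_cst].
- exists (fun x => a * cos (a * x + b)).
    by apply: elem_mul; [exact: elem_cst|exact: elem_cos].
  move=> x; have ha := is_derive_affine a b x.
  by apply: is_derive1_eq (is_derive1_comp (is_derive_sin _) ha); exact: mulrC.
- exists (fun x => (- a) * sin (a * x + b)).
    by apply: elem_mul; [exact: elem_cst|exact: elem_sin].
  move=> x; have ha := is_derive_affine a b x.
  by apply: is_derive1_eq (is_derive1_comp (is_derive_cos _) ha); ring.
- exists (fun x => df x + dg x); first exact: elem_add.
  by move=> x; exact: is_deriveD.
- exists (fun x => f x * dg x + g x * df x).
    by apply: elem_add; exact: elem_mul.
  by move=> x; exact: is_deriveM.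
- exists (fun x => df x * expR (f x)).
    by apply: elem_mul => //; exact: elem_exp.
  move=> x; have fx := fP x.
  by apply: is_derive1_eq (is_derive1_comp (is_derive_expR _) fx); exact: mulrC.
Qed.

Lemma elementary_smooth f : elementary f -> smooth f.
Proof.
move=> ef k.
have [g eg ->] : exists2 g, elementary g & derive1n k f = g.
  elim: k => [|k [g eg fg]]; first by exists f.
  have [dg edg gP] := elementary_derive eg.
  exists dg => //; rewrite derive1nS fg; apply/funext => x.
  by rewrite derive1E; have [] := gP x.
by move=> x; have [dg _ gP] := elementary_derive eg; have [] := gP x.
Qed.

Lemma derive1n_shift k f : derive1n k (derive1 f) = derive1n k.+1 f.
Proof. by rewrite /derive1n -iterSr. Qed.

Lemma smooth_derive f : smooth f -> smooth (derive1 f).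
Proof. by move=> sf k x; rewrite derive1n_shift; exact: sf. Qed.

Lemma smooth_is_derive f x : smooth f -> is_derive x 1 f (derive1 f x).
Proof. by move=> sf; rewrite derive1E; apply/derivableP/(sf 0%N). Qed.

Lemma is_derive_continuous f df : (forall x, is_derive x 1 f (df x)) -> continuous f.
Proof.
by move=> fP x; apply/differentiable_continuous/derivable1_diffP; have [] := fP x.
Qed.

Lemma smooth_continuous f : smooth f -> continuous f.
Proof.
move=> sf; apply: (@is_derive_continuous _ (derive1 f)) => x; exact: smooth_is_derive.
Qed.

Lemma smooth_integ a b f : smooth f -> integ_on a b f.
Proof. by move=> sf; apply: integ_cont; apply: within_cont; exact: smooth_continuous. Qed.

Lemma contD f g : continuous f -> continuous g -> continuous (fun x => f x + g x).
Proof. by move=> cf cg x; exact: (continuousD (cf x) (cg x)). Qed.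

Lemma contM f g : continuous f -> continuous g -> continuous (fun x => f x * g x).
Proof. by move=> cf cg x; exact: (continuousM (cf x) (cg x)). Qed.

Lemma periodic_derive1 L f : periodic f L -> periodic (derive1 f) L.
Proof.
move=> pf x; rewrite /derive1.
suff -> : (fun t : R => t^-1 *: (f (t + (x + L)) - f (x + L))) =
  (fun t => t^-1 *: (f (t + x) - f x)) by [].
by apply/funext => t; rewrite addrA !pf.
Qed.

Lemma test_derive L phi : circle_test L phi -> circle_test L (derive1 phi).
Proof.
by move=> [pp sp]; split; [exact: periodic_derive1|exact: smooth_derive].
Qed.

Lemma test_derive1n k L phi : circle_test L phi -> circle_test L (derive1n k phi).
Proof. by elim: k => [|k IH] tp; [exact: tp|exact: test_derive (IH tp)]. Qed.

Lemma Rint_is_derive a b f F : a <= b -> continuous f ->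
  (forall x, is_derive x 1 F (f x)) -> Rint a b f = F b - F a.
Proof.
rewrite le_eqVlt => /predU1P[->|ab] cf FP; first by rewrite Rintxx subrr.
have cF := is_derive_continuous FP.
rewrite /Rint /Rintegral (@continuous_FTC2 _ _ F)//.
- exact: within_cont.
- split; first by move=> y _; have [] := FP y.
  + by apply: cvg_at_right_filter; exact: cF.
  + by apply: cvg_at_left_filter; exact: cF.
- by move=> y _; rewrite derive1E; have [] := FP y.
Qed.

Lemma test_parts L phi psi : 0 < L -> circle_test L phi -> circle_test L psi ->
  Rint 0 L (fun x => phi x * derive1 psi x) = - Rint 0 L (fun x => derive1 phi x * psi x).
Proof.
move=> L0 [pp sp] [pq sq].
have c1 := smooth_continuous sp; have c2 := smooth_continuous sq.
have c3 := smooth_continuous (smooth_derive sp).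
have c4 := smooth_continuous (smooth_derive sq).
apply/eqP; rewrite -subr_eq0 opprK -RintD; last 2 first.
- by apply: integ_cont; apply: within_cont; exact: contM.
- by apply: integ_cont; apply: within_cont; exact: contM.
have FP x : is_derive x 1 (fun x => phi x * psi x)
    (phi x * derive1 psi x + derive1 phi x * psi x).
  have h1 := smooth_is_derive x sp; have h2 := smooth_is_derive x sq.
  by apply: is_derive1_eq (is_deriveM h1 h2); rewrite /GRing.scale/= [psi x * _]mulrC.
rewrite (Rint_is_derive (ltW L0) _ FP); last first.
  by apply: contD; exact: contM.
by have := pp 0; have := pq 0; rewrite !add0r => -> ->; rewrite subrr.
Qed.

Lemma test_parts_iter L k phi psi : 0 < L -> circle_test L phi -> circle_test L psi ->
  Rint 0 L (fun x => phi x * derive1n k psi x) =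
  (- 1) ^+ k * Rint 0 L (fun x => derive1n k phi x * psi x).
Proof.
move=> L0; elim: k phi psi => [|k IH] phi psi tp tq; first by rewrite expr0 mul1r.
rewrite derive1nS (test_parts L0 tp (test_derive1n k tq)) (IH _ _ (test_derive tp) tq).
by rewrite derive1n_shift exprS; ring.
Qed.

(* With [kappa = pi / L], [sin (kappa x) sin (kappa (b - x))] is [L]-periodic,
   positive on ]0, b[ and negative on ]b, L[; the double exponential turns its
   multiples into smooth approximations of the indicator of [0, b]. *)
Definition bump_phase L b x := sin (pi / L * x) * sin (pi / L * (b - x)).
Definition bump L b k x := expR (- expR (- k.+1%:R * bump_phase L b x)).

Lemma bump_test L b k : 0 < L -> circle_test L (bump L b k).
Proof.
move=> L0; split.
  move=> x; rewrite /bump /bump_phase.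
  have -> : pi / L * (x + L) = pi / L * x + pi by field; rewrite gt_eqF.
  have -> : pi / L * (b - (x + L)) = pi / L * (b - x) - pi by field; rewrite gt_eqF.
  have := sinDpi (pi / L * (b - x) - pi); rewrite subrK => ->.
  by rewrite sinDpi; congr (expR (- expR (_ * _))); ring.
apply: elementary_smooth; rewrite /bump; apply: elem_exp.
have -> : (fun x => - expR (- k.+1%:R * bump_phase L b x)) =
  (fun x => (-1) * expR ((- k.+1%:R) * (sin (pi / L * x + 0) *
     sin ((- (pi / L)) * x + pi / L * b)))).
  apply/funext => x; rewrite mulN1r /bump_phase addr0.
  by congr (- expR (_ * (sin _ * sin _))); ring.
apply: elem_mul; first exact: elem_cst.
apply: elem_exp; apply: elem_mul; first exact: elem_cst.
by apply: elem_mul; exact: elem_sin.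
Qed.

Lemma bump_bounds L b k x : 0 < bump L b k x <= 1.
Proof. by rewrite expR_gt0 expR_le1 oppr_le0 expR_ge0. Qed.

Lemma expRN_le x : 0 < x -> expR (- x) <= x^-1.
Proof.
move=> x0; rewrite expRN lef_pV2 ?posrE ?expR_gt0//.
by apply: le_trans (expR_ge1Dx x); rewrite lerDr.
Qed.

(** For positive phase q, 1 - exp (- s) <= s with s = exp (- (k+1) q); for negative q, the inner
    exponential exceeds (k+1) |q|. Either way the error is at most exp (- (k+1) |q|). *)
Lemma bump_dist L b k x : bump_phase L b x != 0 ->
  `|(0 < bump_phase L b x)%R%:R - bump L b k x| <= `|bump_phase L b x|^-1 * k.+1%:R^-1.
Proof.
move=> q0; have := bump_bounds L b k x; rewrite /bump.
set q := bump_phase L b x in q0 *; move=> /andP[B0 B1].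
have k0 : 0 < k.+1%:R :> R by [].
have qk : 0 < `|q| * k.+1%:R by rewrite mulr_gt0 ?normr_gt0.
rewrite -invfM; apply: le_trans (expRN_le qk).
have [q_gt0|q_lt0] : 0 < q \/ q < 0 by move: q0; rewrite neq_lt => /orP[]; [right|left].
  have -> : (0 < q)%R%:R = 1 :> R by rewrite q_gt0.
  rewrite (gtr0_norm q_gt0) ger0_norm ?subr_ge0//.
  have := expR_ge1Dx (- expR (- k.+1%:R * q)).
  have -> : - (q * k.+1%:R) = - k.+1%:R * q by ring.
  lra.
have -> : (0 < q)%R%:R = 0 :> R by rewrite ltNge ltW.
rewrite sub0r normrN gtr0_norm// (ltr0_norm q_lt0) ler_expR lerN2.
have -> : - q * k.+1%:R = - k.+1%:R * q by ring.
by apply: le_trans (expR_ge1Dx _); rewrite lerDr.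
Qed.

Lemma bump_phase_pos L b x : 0 < L -> 0 < b < L -> 0 < x < L -> x != b ->
  bump_phase L b x != 0 /\ (0 < bump_phase L b x) = (x <= b).
Proof.
move=> L0 /andP[b0 bL] /andP[x0 xL] xb.
have pL : 0 < pi / L by rewrite divr_gt0 ?pi_gt0.
have sp y : 0 < y < L -> 0 < sin (pi / L * y).
  move=> /andP[y0 yL]; apply: sin_gt0_pi; rewrite mulr_gt0//=.
  by rewrite mulrAC ltr_pdivrMr// ltr_pM2l ?pi_gt0.
have s1 : 0 < sin (pi / L * x) by apply: sp; rewrite x0.
rewrite /bump_phase; have [xltb|bltx|xE] := ltgtP x b; last by rewrite xE eqxx in xb.
  have s2 : 0 < sin (pi / L * (b - x)) by apply: sp; lra.
  by rewrite mulf_neq0 ?gt_eqF// mulr_gt0.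
have s2 : 0 < sin (pi / L * (x - b)) by apply: sp; lra.
rewrite -opprB mulrN sinN mulrN oppr_eq0 mulf_neq0 ?gt_eqF// oppr_gt0; split => //.
by apply/negbTE; rewrite -leNgt mulr_ge0// ltW.
Qed.

End smooth_functions.

(** * Fundamental lemma of the calculus of variations on the circle *)

Section fundamental_lemma.
Context {R : realType}.
Implicit Types (a b c x y L : R) (f g h w u v phi psi : R -> R) (k : nat).
Local Notation mu := (@lebesgue_measure R).

Lemma ae_neq a : {ae mu, forall x, x != a}.
Proof.
exists [set a]; split; first exact: measurable_set1.
  exact: lebesgue_measure_set1.
by move=> x /= /negP; rewrite negbK => /eqP.
Qed.

(** The bumps are test functions with values in ]0, 1] tending to the indicator of [0, b], so
    dominated convergence applies with bound [|w|]. *)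
Lemma test_orthogonal_Rint0 L w b : 0 < L -> 0 < b < L -> integ_on 0 L w ->
  (forall psi, circle_test L psi -> Rint 0 L (fun x => w x * psi x) = 0) ->
  Rint 0 b w = 0.
Proof.
move=> L0 b0L wi wP; have /andP[b0 bL] := b0L.
have mw := integ_measurable wi.
pose f_ (k : nat) x := (w x * bump L b k x)%:E.
have sub : [set` `[0, L]] `&` [set` `[0, b]] = [set` `[0, b]].
  by apply: setIidr; apply: subset_itvl; rewrite bnd_simp ltW.
have E : Rint 0 b w = \int[mu]_(x in `[0, L]) (w \_ `[0, b]) x.
  by rewrite -Rintegral_mkcondr sub.
have mr : measurable_fun `[0, L] (w \_ `[0, b]).
  apply/measurable_restrict => //; rewrite sub; apply: measurable_funS mw => //.
  by apply: subset_itvl; rewrite bnd_simp ltW.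
have := @dominated_convergence _ _ _ mu `[0, L] (measurable_itv _) f_
  (EFin \o (w \_ `[0, b])) (fun x => `|w x|%:E).
move=> /(_ _ _ _ _ _)[].
- move=> k; apply/measurable_EFinP; apply: measurable_funM => //.
  by apply: measurable_funTS; apply: continuous_measurable_fun; apply: smooth_continuous;
    have [] := bump_test b k L0.
- exact/measurable_EFinP.
(* At 0, b and L the phase vanishes and every bump equals exp (-1), so these three points are
   discarded. *)
- have aux (P Q : R -> Prop) x (p : P x) (q : Q x) := conj p q.
  have := ae_mono2 (aux _ _) (ae_neq 0) (ae_mono2 (aux _ _) (ae_neq b) (ae_neq L)).
  apply: ae_mono => x [x0 [xb xL]]; rewrite /= in_itv/= => /andP[x0' xL'].
  have xx : 0 < x < L by rewrite !lt_neqAle x0' xL' eq_sym x0 xL.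
  have [q0 qb] := bump_phase_pos L0 b0L xx xb.
  apply/fine_cvgP; split; first exact: nearW.
  rewrite patchE mem_setE/= in_itv/= x0'/=.
  have -> : (if x <= b then w x else point) = w x * (0 < bump_phase L b x)%R%:R.
    by rewrite qb; case: ifP => _; rewrite ?mulr1 ?mulr0.
  apply: cvgM; first exact: cvg_cst.
  apply/cvgrPdist_le => e e0.
  have eq0 : 0 < e * `|bump_phase L b x| by rewrite mulr_gt0 ?normr_gt0.
  have := near_infty_natSinv_lt (PosNum eq0); apply: filterS => k /= kP.
  apply: le_trans (bump_dist k q0) _.
  by rewrite mulrC ler_pdivrMr ?normr_gt0// ltW.
- exact: integ_norm.
- apply: ae_mono (ae_neq 0) => x _ k _; rewrite lee_fin normrM ler_piMr//.
  by have /andP[/ltW ? ?] := bump_bounds L b k x; rewrite ger0_norm.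
move=> _ _; rewrite E /Rintegral.
have -> : (fun k => \int[mu]_(x in `[0%R, L]) f_ k x)%E = cst 0%E.
  apply/funext => k; have tk := bump_test b k L0.
  have fi : integ_on 0 L (fun x => w x * bump L b k x).
    apply: (@integ_eq _ _ _ (fun x => bump L b k x * w x)); first by move=> x _; exact: mulrC.
    by apply: integ_contM wi; apply: within_cont; apply: smooth_continuous; have [] := tk.
  have E0 := congr1 EFin (wP _ tk); rewrite /Rint /Rintegral fineK in E0; first exact: E0.
  exact: (integrable_fin_num _ fi).
by move=> /(cvg_unique (@ereal_hausdorff R))/(_ (cvg_cst _)) /= ->.
Qed.

(** All integrals of [w] from 0 vanish, so Lebesgue differentiation gives the claim. The extension
    by zero turns [w], integrable on the segment only, into an integrable function on the line. *)
Lemma test_orthogonal_ae0 L w : 0 < L -> integ_on 0 L w ->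
  (forall psi, circle_test L psi -> Rint 0 L (fun x => w x * psi x) = 0) ->
  ae_eq_on 0 L w (cst 0).
Proof.
move=> L0 wi wP.
pose w' := w \_ `[0, L].
have w'i y : mu.-integrable `[0, y] (EFin \o w').
  apply: (@integrableS _ _ _ _ setT) => //.
  by rewrite -restrict_EFin; apply/integrable_restrict => //; rewrite setTI.
have := @FTC1 R w' (BLeft 0) w'i (integrable_locally (measurable_itv _) wi).
move=> /(ae_mono2 (fun x p q => conj p q) (ae_mono2 (fun x p q => conj p q) (ae_neq 0) (ae_neq L))).
apply: ae_mono => x [[x0 xL] xP] /andP[x0' xL'].
have {x0 x0'} x0 : 0 < x by rewrite lt_neqAle eq_sym x0.
have {xL xL'} xL : x < L by rewrite lt_neqAle xL.
have /xP[_] : (BLeft 0%R < BRight x)%E by [].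
rewrite {2}/w' patchE mem_setE/= in_itv/= !ltW//= => <-.
rewrite derive1E (@near_eq_derive _ _ _ _ (cst 0)) ?derive_cst//.
have : x \in `]0, L[ by rewrite in_itv/= x0.
move=> /near_in_itvoo; apply: filterS => y; rewrite in_itv/= => y0L.
transitivity (Rint 0 y w); last exact: test_orthogonal_Rint0 wP.
apply: Rint_eq => z /andP[z0 zy].
by rewrite /w' patchE mem_setE/= in_itv/= z0 (le_trans zy)//; lra.
Qed.

End fundamental_lemma.

(** * Weak derivatives and the du Bois-Reymond lemma *)

Section weak_derivatives.
Context {R : realType}.
Implicit Types (a b c x y L : R) (f g h w u v phi psi : R -> R) (k p : nat).
Local Notation mu := (@lebesgue_measure R).

Lemma circle_LpP L p f : circle_Lp L p f ->
  measurable_fun `[0, L] f /\ integ_on 0 L (fun x => `|f x| ^+ p).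
Proof. by move=> [_ mf fi]; split => //; exact: measurable_funTS. Qed.

Lemma circle_L1_integ L f : circle_Lp L 1 f -> integ_on 0 L f.
Proof. by move=> /circle_LpP[mf]; exact: integ_le. Qed.

Lemma circle_L2_sqr L f : circle_Lp L 2 f -> integ_on 0 L (fun x => f x ^+ 2).
Proof.
by move=> /circle_LpP[mf]; apply: integ_eq => x _; rewrite real_normK ?num_real.
Qed.

Lemma circle_L2_integ L f : circle_Lp L 2 f -> integ_on 0 L f.
Proof.
move=> fL; have [mf _] := circle_LpP fL.
by apply: integ_sqr_norm => //; exact: circle_L2_sqr.
Qed.

Lemma integ_testM L v phi : circle_test L phi -> integ_on 0 L v ->
  integ_on 0 L (fun x => v x * phi x).
Proof.
move=> [_ sp] vi; apply: (@integ_eq _ _ _ (fun x => phi x * v x)) => [x _|].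
  exact: mulrC.
by apply: integ_contM vi; apply: within_cont; exact: smooth_continuous.
Qed.

Lemma weak_deriv_unique L k u v1 v2 : 0 < L ->
  is_weak_deriv L k u v1 -> is_weak_deriv L k u v2 -> ae_eq_on 0 L v1 v2.
Proof.
move=> L0 [/circle_L1_integ i1 P1] [/circle_L1_integ i2 P2].
have : ae_eq_on 0 L (fun x => v1 x - v2 x) (cst 0).
  apply: test_orthogonal_ae0 => //; first exact: integB.
  move=> psi tp; transitivity (Rint 0 L (fun x => v1 x * psi x - v2 x * psi x)).
    by apply: Rint_eq => x _; rewrite mulrBl.
  rewrite RintB; [|exact: integ_testM..].
  apply/eqP; rewrite subr_eq0; apply/eqP.
  by apply: (@mulfI _ ((-1) ^+ k)); [rewrite signr_eq0|rewrite -[LHS]P1// -[RHS]P2].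
by apply: ae_mono => x + xL => /(_ xL) /eqP; rewrite subr_eq0 => /eqP.
Qed.

Lemma weak_derivP L k u v : is_weak_deriv L k u v ->
  is_weak_deriv L k u (weak_deriv L k u).
Proof. by move=> uv; apply: (xgetPex (fun=> 0)); exists v. Qed.

Lemma weak_derivS L k u v w :
  is_weak_deriv L k u v -> is_weak_deriv L k.+1 u w -> is_weak_deriv L 1 v w.
Proof.
move=> [_ vP] [wL wP]; split => // phi tp.
have tp' := test_derive tp.
have /= := wP phi tp; have /= := vP _ tp'; rewrite derive1n_shift => -> E.
apply: (@mulfI _ ((-1) ^+ k)); first by rewrite signr_eq0.
by rewrite E exprS expr1 mulN1r !mulNr mul1r mulrN.
Qed.

Lemma test_cst L c : circle_test L (fun=> c).
Proof. by split => //; apply: elementary_smooth; exact: elem_cst. Qed.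

(** Constants are test functions because the circle has no boundary. This is what later closes up
    the continuous representative, [w 0 = w L], and makes every weak derivative eligible for the
    Poincare inequality. *)
Lemma weak_deriv1_mean0 L u v : is_weak_deriv L 1 u v -> Rint 0 L v = 0.
Proof.
move=> [/circle_L1_integ vi /(_ _ (test_cst L 1))].
have -> : derive1n 1 ((fun=> 1) : R -> R) = (fun=> 0).
  by apply/funext => x; rewrite /= derive1_cst.
rewrite expr1 /circle_int mulN1r => /eqP; rewrite eq_sym eqr_oppLR => /eqP E.
transitivity (Rint 0 L (fun x => v x * 1)); first by apply: Rint_eq => x _; rewrite mulr1.
rewrite /Rint E -[X in - X]/(Rint 0 L (fun x => u x * 0)).
rewrite (@Rint_eq _ _ _ _ (fun x => 0 * 0)) => [|x _]; last by rewrite !mulr0.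
rewrite RintZ ?mul0r ?oppr0//; exact: integ_cst.
Qed.

Lemma smooth_primitive psi : smooth psi ->
  exists2 phi, smooth phi & derive1 phi = psi.
Proof.
move=> sp.
(* As [Rint] vanishes for reversed bounds, no fixed base point serves the whole line. The base [A x]
   lies below both x and 0, and subtracting the integral up to 0 makes the value independent of the
   base. *)
pose A x := - `|x| - 1.
pose F x := Rint (A x) x psi - Rint (A x) 0 psi.
have ip a b : integ_on a b psi by exact: smooth_integ.
have FE B x : B <= A x -> F x = Rint B x psi - Rint B 0 psi.
  move=> BA; have := ler_norm (- x); rewrite normrN => nx.
  have := normr_ge0 x; rewrite /F /A in BA * => x0.
  rewrite (@Rint_split _ B x (- `|x| - 1))//; last by lra.
  by rewrite (@Rint_split _ B 0 (- `|x| - 1))//; lra.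
have FP x : is_derive x 1 F (psi x).
  (* One base point that lies below [A y] for all y within distance 1 of x. *)
  pose B := - `|x| - 2.
  have Bx : B < x.
    by have := ler_norm (- x); rewrite normrN /B; lra.
  have xx1 : x < x + 1 by lra.
  have cp : {for x, continuous psi} by exact: smooth_continuous.
  have [d1 d2] := continuous_FTC1_closed xx1 (ip B (x + 1)) Bx cp.
  have h : is_derive x 1 (fun y => Rint B y psi) (psi x).
    by rewrite -d2 derive1E; exact/derivableP.
  have hG : is_derive x 1 (fun y => Rint B y psi - Rint B 0 psi) (psi x).
    by apply: is_derive1_eq (is_deriveB h (is_derive_cst (Rint B 0 psi) x 1)); rewrite subr0.
  apply: near_eq_is_derive hG.
  near=> y; rewrite (@FE B)// /B /A.
  have : `|x - y| < 1 by near: y; apply: cvgr_dist_lt => //; exact: cvg_id.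
  have := ler_distD x y 0; rewrite !subr0 distrC; lra.
have dF : derive1 F = psi.
  by apply/funext => x; rewrite derive1E; have [] := FP x.
exists F; last exact: dF.
case=> [|k] x; first by have [] := FP x.
by rewrite -derive1n_shift dF; exact: sp.
Unshelve. all: by end_near. Qed.

Lemma test_primitive L psi : 0 < L -> circle_test L psi -> Rint 0 L psi = 0 ->
  exists2 phi, circle_test L phi & derive1 phi = psi.
Proof.
move=> L0 [pp sp] p0; have [phi sphi dphi] := smooth_primitive sp.
exists phi => //; split => //.
have dP x : is_derive x 1 phi (psi x) by rewrite -dphi; exact: smooth_is_derive.
have cst x : phi (x + L) - phi x = phi (0 + L) - phi 0.
  apply: (@is_derive_0_is_cst _ (fun x => phi (x + L) - phi x)) => y.
  have hs : is_derive y 1 (fun x => x + L) 1.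
    by have := is_derive_affine 1 L y; under eq_fun do rewrite mul1r.
  have h1 := @is_derive1_comp _ phi (fun x => x + L) y _ _ (dP (y + L)) hs.
  by apply: is_derive1_eq (is_deriveB h1 (dP y)); rewrite pp; ring.
by move=> x; apply/eqP; rewrite -subr_eq0 cst add0r -(Rint_is_derive (ltW L0) (smooth_continuous sp) dP) p0.
Qed.

(** With V the indefinite integral of [v], the difference [z = u - V] annihilates derivatives of
    test functions, that is, all test functions of mean zero. Subtracting from [psi] its mean c
    shows that z minus its own mean d annihilates every test function. *)
Lemma weak_deriv1_primitive L u v : 0 < L -> integ_on 0 L u ->
  is_weak_deriv L 1 u v -> exists d, ae_eq_on 0 L u (fun x => d + Rint 0 x v).
Proof.
move=> L0 ui uv; have v0 := weak_deriv1_mean0 uv.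
case: (uv) => /circle_L1_integ vi vP.
pose V x := Rint 0 x v.
have Vi : integ_on 0 L V by apply: integ_cont; exact: Rint_continuous (ltW L0) vi.
pose z x := u x - V x.
have zi : integ_on 0 L z by exact: integB.
have Lneq : L != 0 by rewrite gt_eqF.
pose d := L^-1 * Rint 0 L z.
exists d.
suff : ae_eq_on 0 L (fun x => z x - d) (cst 0).
  by apply: ae_mono => x + xL => /(_ xL); rewrite /z /V /=; lra.
apply: test_orthogonal_ae0 => //; first by apply: integB => //; exact: integ_cst.
move=> psi tp; have [pp sp] := tp.
pose c := L^-1 * Rint 0 L psi.
have ip : integ_on 0 L psi by exact: smooth_integ.
have tq : circle_test L (fun x => psi x + - c).
  split; first by move=> x; rewrite pp.
  case=> [|k] x.
    exact: (derivableD (sp 0%N x) (derivable_cst (- c) x 1)).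
  rewrite -derive1n_shift.
  have -> : derive1 (fun x => psi x + - c) = derive1 psi.
    apply/funext => y; rewrite derive1E.
    have hy := smooth_is_derive y sp.
    by have [_ ->] := is_deriveD hy (is_derive_cst (- c) y 1); rewrite addr0.
  by rewrite derive1n_shift; exact: sp.
have [phi tphi dphi] : exists2 phi, circle_test L phi & derive1 phi = (fun x => psi x + - c).
  apply: test_primitive => //; rewrite RintD//; last exact: integ_cst.
  by rewrite Rint_cst ?(ltW L0)// /c; field.
have [pphi sphi] := tphi.
have zphi : Rint 0 L (fun x => z x * (psi x + - c)) = 0.
  rewrite -[fun x => _]/(fun x => z x * (fun y => psi y + - c) x) -dphi.
  transitivity (Rint 0 L (fun x => u x * derive1 phi x - V x * derive1 phi x)).
    by apply: Rint_eq => x _; rewrite /z mulrBl.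
  rewrite RintB; [|exact: integ_testM (test_derive tphi) _..].
  have -> : Rint 0 L (fun x => u x * derive1 phi x) =
    -1 * Rint 0 L (fun x => v x * phi x) by exact: vP tphi.
  rewrite /V (Rint_parts (ltW L0) vi (fun x => smooth_is_derive x sphi)).
    by rewrite v0 mul0r mulN1r; lra.
  by rewrite dphi; exact: smooth_continuous tq.2.
have zt := integ_testM tp zi.
transitivity (Rint 0 L (fun x => z x * psi x - d * psi x)).
  by apply: Rint_eq => x _; rewrite mulrBl.
rewrite RintB//; last exact: integZ.
rewrite RintZ//.
(* The mean is moved from [psi] to z: c times the integral of z equals d times the integral of
   [psi], both being [L^-1] times the product of the two integrals. *)
have : Rint 0 L (fun x => z x * psi x - c * z x) = 0.
  by apply: etrans zphi; apply: Rint_eq => x _; ring.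
rewrite RintB//; last exact: integZ.
by rewrite RintZ// /c /d => E; apply: etrans E; ring.
Qed.

Lemma weak_deriv1_cst L u v c : 0 < L -> measurable_fun `[0, L] u ->
  ae_eq_on 0 L u (cst c) -> is_weak_deriv L 1 u v -> ae_eq_on 0 L v (cst 0).
Proof.
move=> L0 mu_ uc [/circle_L1_integ vi vP]; apply: test_orthogonal_ae0 => // phi tp.
have /= := vP _ tp; rewrite expr1 mulN1r => E.
apply: oppr_inj; rewrite -[LHS]E oppr0.
have tp' := test_derive tp; have sp' := tp'.2.
transitivity (Rint 0 L (fun x => c * derive1 phi x)).
  apply: Rint_ae.
  - apply: measurable_funM => //; apply: integ_measurable; exact: smooth_integ.
  - by apply: integ_measurable; apply: integZ; exact: smooth_integ.
  - by apply: ae_mono uc => x + xL => /(_ xL) ->.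
rewrite RintZ; last exact: smooth_integ.
have sp := tp.2.
rewrite (Rint_is_derive (ltW L0) (smooth_continuous sp') (fun x => smooth_is_derive x sp)).
by have := tp.1 0; rewrite add0r => ->; rewrite subrr mulr0.
Qed.

Lemma test_circle_Lp L p u : circle_test L u -> circle_Lp L p u.
Proof.
move=> [pu su]; have cu := smooth_continuous su; split => //.
  exact: continuous_measurable_fun.
apply: integ_cont; apply: within_cont => x.
apply: (@continuous_comp _ _ _ (fun x => `|u x|) (fun y => y ^+ p)).
  by apply: (@continuous_comp _ _ _ u (fun y : R => `|y|)); [exact: cu|exact: norm_continuous].
exact: exprn_continuous.
Qed.

Lemma test_weak_deriv L k u : 0 < L -> circle_test L u ->
  is_weak_deriv L k u (derive1n k u).
Proof.
move=> L0 tu; split; first by apply: test_circle_Lp; exact: test_derive1n.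
by move=> phi tp; exact: test_parts_iter.
Qed.

End weak_derivatives.

(** * The potential well *)

Section potential.
Context {R : realType}.
Implicit Types (a b c d x y v E m M s : R) (f g : R -> R).

Lemma within_contI a b f :
  (forall x, a <= x <= b -> forall e, 0 < e ->
    exists2 r, 0 < r & forall y, a <= y <= b -> `|y - x| < r -> `|f y - f x| < e) ->
  {within `[a, b], continuous f}.
Proof.
move=> fP; apply/subspace_continuousP => x /=; rewrite in_itv/= => xab.
apply/cvgrPdist_lt => e e0; have [r r0 rP] := fP x xab e e0.
apply/nbhs_ballP; exists r => //= y; rewrite /ball/= => yx yab.
by rewrite distrC; apply: rP; rewrite ?in_itv// distrC.
Qed.

Lemma within_cont_comp a b c d f g : {within `[c, d], continuous g} ->
  {within `[a, b], continuous f} -> (forall x, a <= x <= b -> c <= f x <= d) ->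
  {within `[a, b], continuous (fun x => g (f x))}.
Proof.
move=> cg cf fab; apply: within_contI => x xab e e0.
have [r r0 rP] := within_contP cg (fab x xab) e0.
have [r' r'0 r'P] := within_contP cf xab r0.
by exists r' => // y yab yx; apply: rP; [exact: fab|exact: r'P].
Qed.

Lemma within_asin : {within `[-1, 1], continuous (@asin R)}.
Proof.
have : {within `[sin (- (pi / 2)), sin (pi / 2)], continuous (@asin R)}.
  apply: (@segment_can_le_continuous _ _ _ sin) => //.
  - by have := pi_gt0 R; lra.
  - by apply: within_cont; exact: continuous_sin.
  - exact: sinK.
by rewrite sinN sin_pihalf.
Qed.

Lemma asin1 : asin 1 = pi / 2 :> R.
Proof.
have h : pi / 2 \in `[- (pi / 2), pi / 2 :> R].
  by rewrite in_itv/=; have := pi_gt0 R; lra.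
by have := sinK h; rewrite sin_pihalf.
Qed.

Lemma asinN1 : asin (- 1) = - (pi / 2) :> R.
Proof.
have h : - (pi / 2) \in `[- (pi / 2), pi / 2 :> R].
  by rewrite in_itv/=; have := pi_gt0 R; lra.
by have := sinK h; rewrite sinN sin_pihalf.
Qed.

Lemma continuous_xlnx : continuous (fun x : R => x * ln x).
Proof.
move=> x; have [x0|x0|x0] := ltgtP x 0.
- apply/cvgrPdist_lt => e e0; near=> y.
  have y0 : y < 0 by near: y; exact: lt_nbhsl.
  by rewrite !ln0 ?mulr0 ?subrr ?normr0// ltW.
- by apply: continuousM; [exact: cvg_id|exact: continuous_ln].
rewrite x0; apply/cvgrPdist_lt => e e0.
have e20 : 0 < (e / 2) ^+ 2 by rewrite exprn_gt0// divr_gt0.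
near=> y; rewrite mul0r sub0r normrN.
have [y0|y0] := leP y 0; first by rewrite ln0// mulr0 normr0.
have y1 : y < 1.
  by near: y; apply: lt_nbhsl; rewrite ltr01.
have ye : y < (e / 2) ^+ 2 by near: y; apply: lt_nbhsl.
(* With y = s^2, |y ln y| = 2 s (- s ln s), and - ln s < 1 / s leaves less than 2 s < e. *)
pose s := Num.sqrt y.
have s0 : 0 < s by rewrite sqrtr_gt0.
have ss : y = s ^+ 2 by rewrite sqr_sqrtr// ltW.
have s1 : s < e / 2.
  by rewrite -(@ltr_pXn2r _ 2)// ?nnegrE ?divr_ge0 ?ltW// -ss.
have lns : - ln s < s^-1.
  by rewrite -lnV ?posrE//; apply: ln_sublinear; rewrite invr_gt0.
have lny : ln y = 2 * ln s by rewrite ss lnXn// mulr_natl.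
have lny0 : ln y < 0 by apply: ln_lt0; rewrite y0 y1.
rewrite ler0_norm; last by rewrite mulr_ge0_le0 ?ltW.
rewrite lny ss.
have : s * (- ln s) < 1.
  by rewrite -(@mulfV _ s) ?gt_eqF// ltr_pM2l.
nra.
Unshelve. all: by end_near. Qed.

Lemma xlnx_ge v : 0 < v -> v - 1 <= v * ln v.
Proof.
move=> v0; have := @le_ln1Dx R (v^-1 - 1).
rewrite addrCA subrr addr0 lnV ?posrE//.
have vi0 : 0 < v^-1 by rewrite invr_gt0.
have h : -1 < v^-1 - 1 by lra.
move=> /(_ h); have : v * v^-1 = 1 by rewrite mulfV// gt_eqF.
nra.
Qed.

(* Minimal on the half-line at 1, with value 0; [ln 0 = 0] gives [well 0 = 1 / 2]. *)
Definition well v := (v ^+ 2 * ln (v ^+ 2) - v ^+ 2 + 1) / 2.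

Lemma well_pos v : 0 < v -> well v = v ^+ 2 * ln v - v ^+ 2 / 2 + 2^-1.
Proof. by move=> v0; rewrite /well lnXn// mulr2n; field. Qed.

Lemma well0 : well 0 = 2^-1. Proof. by rewrite /well expr0n/= mul0r subrr add0r mul1r. Qed.

Lemma well1 : well 1 = 0. Proof. by rewrite /well expr1n ln1; lra. Qed.

Lemma continuous_well : continuous well.
Proof.
have csq : continuous (fun v : R => v ^+ 2) by move=> v; exact: exprn_continuous.
have h1 : continuous (fun v : R => v ^+ 2 * ln (v ^+ 2)).
  move=> v; apply: (@continuous_comp _ _ _ (fun v => v ^+ 2) (fun x => x * ln x)).
    exact: csq.
  exact: continuous_xlnx.
have h2 : continuous (fun v : R => - v ^+ 2).
  by move=> v; exact: (continuousN (csq v)).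
have hc c : continuous (fun _ : R => c) by exact: cst_continuous.
exact: (contM (contD (contD h1 h2) (hc 1)) (hc 2^-1)).
Qed.

Lemma is_derive_well v : 0 < v -> is_derive v 1 well (2 * (v * ln v)).
Proof.
move=> v0.
have hl := is_derive1_ln v0.
have hv : is_derive v 1 (id : R -> R) 1 by exact: is_derive_id.
have h2 := is_deriveM hv hv.
have h3 := is_deriveD (is_deriveB (is_deriveM h2 hl) (is_deriveZ 2^-1 h2)) (is_derive_cst (2^-1 : R) v 1).
have h4 : is_derive v 1 (fun v => v * v * ln v - 2^-1 * (v * v) + 2^-1) (2 * (v * ln v)).
  apply: is_derive1_eq h3; rewrite /GRing.scale/= !fctE.
  by field; rewrite gt_eqF.
apply: near_eq_is_derive h4.
near=> y; rewrite well_pos; first by ring.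
by near: y; exact: lt_nbhsr.
Unshelve. all: by end_near. Qed.

End potential.

(** * Bounds for the well and the primitive of its action *)

Section calibration.
Context {R : realType}.
Implicit Types (a b c d x y v E m M s p q C : R) (f g Phi : R -> R).

Lemma is_derive_within a b f df : (forall x, a <= x <= b -> is_derive x 1 f (df x)) ->
  {within `[a, b], continuous f}.
Proof.
move=> fP; apply: continuous_in_subspaceT => x; rewrite inE/= in_itv/= => xab.
by apply/differentiable_continuous/derivable1_diffP; have [] := fP x xab.
Qed.

Lemma le_of_derive_sign c f df v : c < 1 -> c < v ->
  (forall x, c < x -> is_derive x 1 f (df x)) ->
  (forall x, c < x -> 0 <= (x - 1) * df x) -> f 1 <= f v.
Proof.
move=> c1 cv fP dP; have [v1|v1|->//] := ltgtP v 1.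
- have := @MVT R f df v 1 v1 => /(_ _ _)[].
  + by move=> x; rewrite in_itv/= => /andP[vx _]; apply: fP; exact: lt_trans vx.
  + apply: (@is_derive_within _ _ _ df) => x /andP[vx _]; apply: fP.
    exact: lt_le_trans vx.
  move=> x; rewrite in_itv/= => /andP[vx x1] E.
  have := dP x (lt_trans cv vx); rewrite nmulr_rge0 ?subr_lt0// => dx.
  by rewrite -subr_le0 E mulr_le0_ge0// subr_ge0 ltW.
- have := @MVT R f df 1 v v1 => /(_ _ _)[].
  + by move=> x; rewrite in_itv/= => /andP[vx _]; apply: fP; exact: lt_trans vx.
  + apply: (@is_derive_within _ _ _ df) => x /andP[vx _]; apply: fP.
    exact: lt_le_trans vx.
  move=> x; rewrite in_itv/= => /andP[vx x1] E.
  have := dP x (lt_trans c1 vx); rewrite pmulr_rge0 ?subr_gt0// => dx.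
  by rewrite -subr_ge0 E mulr_ge0// subr_ge0 ltW.
Qed.

Lemma xlnx_sign x : 0 < x -> 0 <= (x - 1) * (x * ln x).
Proof.
move=> x0; have [x1|x1] := leP 1 x.
  by rewrite mulr_ge0 ?subr_ge0// mulr_ge0 ?ln_ge0// ltW.
rewrite mulr_le0 ?subr_le0 ?(ltW x1)// mulr_ge0_le0 ?(ltW x0)//.
by apply: ltW; apply: ln_lt0; rewrite x0.
Qed.

Lemma well_ge0 v : 0 <= well v.
Proof.
have Wn : well v = well `|v| by rewrite /well real_normK ?num_real.
rewrite Wn; have := normr_ge0 v; rewrite le_eqVlt => /predU1P[<-|v0].
  by rewrite well0 invr_ge0.
rewrite -(@well1 R); apply: (@le_of_derive_sign 0 well (fun x => 2 * (x * ln x))) => //.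
  by move=> x; exact: is_derive_well.
by move=> x x0; have := xlnx_sign x0; nra.
Qed.

(* Equivalently, the inverse of [v |-> y := sgn (v - 1) sqrt (well v)] has
   derivative at least [1 - y / 3], a bound whose even part is constant. *)
Lemma well_lower v : 0 < v -> (3 * (v * ln v)) ^+ 2 <= well v * (3 + v * ln v) ^+ 2.
Proof.
move=> v0.
have p3 x : 0 < x -> 0 < 3 + x * ln x by move=> x0; have := xlnx_ge x0; lra.
(* f vanishes at 1, and its derivative is that of the well times a factor that B below shows to be
   nonnegative. *)
pose f x := well x - (3 * (x * ln x) / (3 + x * ln x)) ^+ 2.
pose df x := 2 * (x * ln x) * (1 - 27 * (1 + ln x) / (3 + x * ln x) ^+ 3).
have : f 1 <= f v.
  apply: (@le_of_derive_sign 0 f df) => // x x0.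
    have hW := is_derive_well x0; have hl := is_derive1_ln x0.
    have p0 := p3 x x0.
    have hx : is_derive x 1 (id : R -> R) 1 by exact: is_derive_id.
    have hp : is_derive x 1 (fun x => x * ln x) (1 + ln x).
      apply: is_derive1_eq (is_deriveM hx hl).
      by rewrite /GRing.scale/=; field; rewrite gt_eqF.
    have hq : is_derive x 1 (fun x => 3 + x * ln x) (1 + ln x).
      by apply: is_derive1_eq (is_deriveD (is_derive_cst (3 : R) x 1) hp); rewrite add0r.
    have q0 : 3 + x * ln x != 0 by rewrite gt_eqF.
    have hi := @is_deriveV _ (fun x => 3 + x * ln x) _ _ _ q0 hq.
    have h3 : is_derive x 1 (fun x => 3 * (x * ln x)) (3 * (1 + ln x)).
      by apply: is_derive1_eq (is_deriveZ 3 hp).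
    have ht := is_deriveM h3 hi.
    have h := is_deriveB hW (is_deriveM ht ht).
    apply: is_derive1_eq h.
    rewrite /GRing.scale/= !fctE /df.
    by field; rewrite !gt_eqF.
  have p0 := p3 x x0.
  (* With p = x ln x: 1 + ln x <= 1 + p <= (1 + p / 3)^3. *)
  have B : 1 + ln x <= ((3 + x * ln x) / 3) ^+ 3.
    have h1 : ln x <= x * ln x.
      have [x1|x1] := leP 1 x; first by rewrite ler_peMl// ln_ge0.
      have lx : ln x < 0 by apply: ln_lt0; rewrite x0.
      by nra.
    apply: (@le_trans _ _ (1 + x * ln x)); first by rewrite lerD2l.
    have := xlnx_ge x0; set p := x * ln x => p1.
    rewrite -subr_ge0 (_ : _ - _ = (p / 3) ^+ 2 * (3 + p / 3)); last by field.
    by rewrite mulr_ge0 ?sqr_ge0//; lra.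
  rewrite /df mulrA mulr_ge0//; first by have := xlnx_sign x0; nra.
  rewrite subr_ge0 ler_pdivrMr ?exprn_gt0// mul1r.
  by move: B; rewrite expr_div_n ler_pdivlMr ?exprn_gt0//; lra.
rewrite /f well1 ln1 !mulr0 mul0r expr0n/= subr0 subr_ge0 expr_div_n.
by rewrite ler_pdivrMr// exprn_gt0// p3.
Qed.

Lemma well_incr x y : 1 <= x -> x < y -> well x < well y.
Proof.
move=> x1 xy; have := @MVT R well (fun x => 2 * (x * ln x)) x y xy => /(_ _ _)[].
- by move=> z; rewrite in_itv/= => zxy; apply: is_derive_well; lra.
- by apply: within_cont; exact: continuous_well.
move=> z; rewrite in_itv/= => /andP[xz zy] E.
rewrite -subr_gt0 E mulr_gt0 ?subr_gt0// mulr_gt0// mulr_gt0//; first lra.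
by apply: ln_gt0; lra.
Qed.

Lemma well_decr x y : 0 <= x -> x < y -> y <= 1 -> well y < well x.
Proof.
move=> x0 xy y1; have := @MVT R well (fun x => 2 * (x * ln x)) x y xy => /(_ _ _)[].
- by move=> z; rewrite in_itv/= => zxy; apply: is_derive_well; lra.
- by apply: within_cont; exact: continuous_well.
move=> z; rewrite in_itv/= => /andP[xz zy] E.
have lz : ln z < 0 by apply: ln_lt0; lra.
have z0 : 0 < z by lra.
rewrite -subr_lt0 E pmulr_llt0 ?subr_gt0// pmulr_rlt0//.
by rewrite pmulr_rlt0.
Qed.

(** The well strictly decreases on [0, 1] and strictly increases afterwards, so equal levels sit on
    opposite sides of 1. The cap [2^-1] is the height [well 0] of the left end. *)
Lemma well_level m M : 0 <= m -> m < M -> well m = well M ->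
  [/\ m < 1, 1 < M, 0 < well M, well M <= 2^-1 & forall v, m < v < M -> well v < well M].
Proof.
move=> m0 mM E.
have m1 : m < 1.
  by rewrite ltNge; apply/negP => m1; have := well_incr m1 mM; rewrite E ltxx.
have M1 : 1 < M.
  by rewrite ltNge; apply/negP => M1; have := well_decr m0 mM M1; rewrite E ltxx.
split => //.
- by rewrite -(@well1 R); exact: well_incr.
- rewrite -E -(@well0 R); move: m0; rewrite le_eqVlt => /predU1P[<-//|m0].
  by apply/ltW/well_decr => //; exact: ltW.
- move=> v /andP[mv vM]; have [v1|v1] := leP 1 v; first exact: well_incr.
  by rewrite -E; apply: well_decr => //; exact: ltW.
Qed.

(* A primitive of [(1 - y / 3) sqrt (E - y^2)]. *)
Definition Psi E y := (y * Num.sqrt (E - y ^+ 2) + E * asin (y / Num.sqrt E)) / 2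
  + (E - y ^+ 2) * Num.sqrt (E - y ^+ 2) / 9.

(** The first summand of [Psi] is the area function of the disc of radius sqrt E, with derivative
    sqrt (E - y^2); the second is (E - y^2)^(3/2) / 9, which supplies the factor - y / 3. *)
Lemma is_derive_Psi E y : 0 < E -> y ^+ 2 < E ->
  is_derive y 1 (Psi E) ((1 - y / 3) * Num.sqrt (E - y ^+ 2)).
Proof.
move=> E0 yE.
have D0 : 0 < E - y ^+ 2 by rewrite subr_gt0.
set r := Num.sqrt (E - y ^+ 2).
have r0 : 0 < r by rewrite sqrtr_gt0.
have rr : r ^+ 2 = E - y ^+ 2 by rewrite sqr_sqrtr// ltW.
set Y := Num.sqrt E.
have Y0 : 0 < Y by rewrite sqrtr_gt0.
have YY : Y ^+ 2 = E by rewrite sqr_sqrtr// ltW.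
have hx : is_derive y 1 (id : R -> R) 1 by exact: is_derive_id.
have hD := is_deriveB (is_derive_cst E y 1) (is_deriveM hx hx).
have {}hD : is_derive y 1 (fun y => E - y * y) (- (2 * y)).
  by apply: is_derive1_eq hD; rewrite /GRing.scale/=; ring.
have D0' : 0 < E - y * y by rewrite -expr2.
have hs := @is_derive1_comp _ Num.sqrt (fun y => E - y * y) y _ _ (is_derive1_sqrt D0') hD.
have ha1 : is_derive y 1 (fun y => Y^-1 * y) Y^-1.
  by apply: is_derive1_eq (is_deriveZ Y^-1 hx); rewrite /GRing.scale/= mulr1.
have yY : -1 < Y^-1 * y < 1.
  rewrite mulrC ltr_pdivrMr// ltr_pdivlMr// mul1r mulN1r.
  have yY2 : y ^+ 2 < Y ^+ 2 by rewrite YY.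
  by nra.
have ha := @is_derive1_comp _ asin (fun y => Y^-1 * y) y _ _ (is_derive1_asin yY) ha1.
have asE : Num.sqrt (1 - (Y^-1 * y) ^+ 2) = r / Y.
  rewrite -[RHS]ger0_norm; last by rewrite divr_ge0// ltW.
  rewrite -sqrtr_sqr; congr (Num.sqrt _); rewrite expr_div_n rr exprMn exprVn YY.
  by field; rewrite gt_eqF.
have h := is_deriveD (is_deriveZ 2^-1 (is_deriveD (is_deriveM hx hs) (is_deriveZ E ha)))
  (is_deriveZ 9^-1 (is_deriveM hD hs)).
have PE : Psi E = (fun y => 2^-1 * (y * Num.sqrt (E - y * y) + E * asin (Y^-1 * y))
   + 9^-1 * ((E - y * y) * Num.sqrt (E - y * y))).
  by apply/funext => z; rewrite /Psi -/Y -expr2 [z / Y]mulrC; field.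
rewrite PE; apply: is_derive1_eq h.
have sE : Num.sqrt (E - y * y) = r by rewrite /r expr2.
have D2 : E - y * y = r ^+ 2 by rewrite rr expr2.
have EY : E * ((r / Y)^-1 / Y) = (r ^+ 2 + y ^+ 2) / r.
  by rewrite rr subrK -YY; field; rewrite !gt_eqF.
rewrite /GRing.scale/= sE D2 asE EY.
by field; rewrite gt_eqF.
Qed.

End calibration.

(** * The calibrating function *)

Section calibrating_function.
Context {R : realType}.
Implicit Types (a b c d x y v E m M s p q C : R) (f g Phi : R -> R).

Lemma within_Psi E : 0 < E ->
  {within `[- Num.sqrt E, Num.sqrt E], continuous (Psi E)}.
Proof.
move=> E0; set Y := Num.sqrt E.
have Y0 : 0 < Y by rewrite sqrtr_gt0.
have cid : continuous (fun y : R => y) by move=> y; exact: cvg_id.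
have cc c : continuous (fun _ : R => c) by exact: cst_continuous.
have cD : continuous (fun y => E - y ^+ 2).
  apply: (contD (cc E)) => y.
  exact: (continuousN (@exprn_continuous _ 2 y)).
have cS : continuous (fun y => Num.sqrt (E - y ^+ 2)).
  by move=> y; apply: (@continuous_comp _ _ _ (fun y => E - y ^+ 2) Num.sqrt);
    [exact: cD|exact: sqrt_continuous].
have cA : {within `[- Y, Y], continuous (fun y => asin (y / Y))}.
  apply: (within_cont_comp within_asin).
    by apply: within_cont; exact: contM.
  by move=> y /andP[y1 y2]; rewrite ler_pdivlMr// ler_pdivrMr// mulN1r mul1r y1.
have wD (f g : R -> R) : {within `[- Y, Y], continuous f} ->
    {within `[- Y, Y], continuous g} -> {within `[- Y, Y], continuous (fun x => f x + g x)}.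
  by move=> cf cg x; apply: continuousD; [exact: cf|exact: cg].
exact: (wD _ _ (within_contM (wD _ _ (within_cont (contM cid cS))
  (within_contM (within_cont (cc E)) cA)) (within_cont (cc 2^-1)))
  (within_cont (contM (contM cD cS) (cc 9^-1)))).
Qed.

(** The square roots vanish at both ends, which removes the odd correction; the arcsine leaves the
    area of a half disc of radius sqrt E. *)
Lemma Psi_total E : 0 < E ->
  Psi E (Num.sqrt E) - Psi E (- Num.sqrt E) = E * (pi / 2).
Proof.
move=> E0; have Y0 : Num.sqrt E != 0 by rewrite gt_eqF// sqrtr_gt0.
rewrite /Psi sqrrN sqr_sqrtr ?ltW// subrr sqrtr0 !mulNr mulfV// asin1 asinN1.
by field.
Qed.

(** The sign [sg] selects the branch of y on either side of 1, so one computation covers both. The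
    chain rule yields (1 - y / 3) sqrt (E - well v) dy/dv, and [well_lower] says that (1 - y / 3)
    |dy/dv| <= 1. *)
Lemma Psi_branch_derive E sg v : 0 < E <= 2^-1 -> 0 < v -> well v < E ->
  sg ^+ 2 = 1 -> 0 < sg * (v - 1) ->
  exists2 D, is_derive v 1 (fun v => Psi E (sg * Num.sqrt (well v))) D &
    `|D| <= Num.sqrt (E - well v).
Proof.
move=> /andP[E0 E2] v0 WE sg2 sgv.
have well_gt0 : 0 < well v.
  rewrite lt_neqAle well_ge0 andbT eq_sym; apply/eqP => well0'.
  have [v1|v1|v1] := ltgtP v 1.
  - by have := well_decr (ltW v0) v1 (lexx _); rewrite well1 well0' ltxx.
  - by have := well_incr (lexx _) v1; rewrite well1 well0' ltxx.
  - by rewrite v1 subrr mulr0 ltxx in sgv.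
set r := Num.sqrt (well v).
have r0 : 0 < r by rewrite sqrtr_gt0.
have rr : r ^+ 2 = well v by rewrite sqr_sqrtr// ltW.
have hr := @is_derive1_comp _ Num.sqrt well v _ _ (is_derive1_sqrt well_gt0) (is_derive_well v0).
have hsr := is_deriveZ sg hr.
have yE : (sg * r) ^+ 2 < E by rewrite exprMn sg2 mul1r rr.
have hP := @is_derive1_comp _ (Psi E) (sg \*: (Num.sqrt \o well)) v _ _ (is_derive_Psi E0 yE) hsr.
eexists; first exact: hP.
rewrite exprMn sg2 mul1r rr /GRing.scale/= -/r.
set t := Num.sqrt (E - well v); have t0 : 0 <= t by rewrite sqrtr_ge0.
set p := v * ln v.
have p_ge : v - 1 <= p by exact: xlnx_ge.
have low : (3 * p) ^+ 2 <= (r * (3 + p)) ^+ 2 by rewrite [leRHS]exprMn rr; exact: well_lower.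
have p30 : 0 <= r * (3 + p) by rewrite mulr_ge0 ?ltW//; lra.
have pb : `|3 * p| <= r * (3 + p).
  by rewrite -(ger0_norm p30) -ler_sqr ?nnegrE// !real_normK ?num_real.
have sp : 0 <= sg * p.
  have := xlnx_sign v0; rewrite -/p => vp.
  have : 0 <= (sg * (v - 1)) * (sg * p).
    by rewrite mulrACA -expr2 sg2 mul1r.
  by rewrite pmulr_rge0.
have sn : `|sg| = 1.
  by apply/eqP; rewrite -(@eqrXn2 _ 2)// expr1n real_normK ?num_real// sg2.
have qE : sg * p = `|p| by rewrite -(ger0_norm sp) normrM sn mul1r.
have r1 : r < 1.
  by rewrite -(@ltr_pXn2r _ 2) ?nnegrE// ?ltW// rr expr1n; lra.
have sgle : -1 <= sg <= 1 by rewrite -ler_norml sn.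
have k0 : 0 <= 1 - sg * r / 3 by nra.
have -> : (1 - sg * r / 3) * t * (sg * ((2 * r)^-1 * (2 * p))) =
   t * ((1 - sg * r / 3) * `|p| / r) by rewrite -qE; field; rewrite gt_eqF.
rewrite ger0_norm; last by rewrite mulr_ge0// divr_ge0 ?(ltW r0)// mulr_ge0.
rewrite -[leRHS]mulr1 ler_wpM2l// ler_pdivrMr// mul1r.
have : (1 - sg * r / 3) * `|p| = `|p| - r * p / 3.
  by rewrite -qE; transitivity (sg * p - (sg ^+ 2) * r * p / 3); [field|rewrite sg2 mul1r].
move=> ->; move: pb; rewrite normrM ger0_norm//.
lra.
Qed.

(** Strict conditions are imposed only inside ]p, q[: the derivative may break down at 0, at 1 and
    on the level E, but the mean value theorem needs no more than continuity there. *)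
Lemma Psi_branch_lip E sg p q C : 0 < E <= 2^-1 -> sg ^+ 2 = 1 ->
  0 <= p -> p <= q -> (forall v, p < v < q -> 0 < sg * (v - 1)) ->
  (forall v, p < v < q -> well v < E) -> well p <= E -> well q <= E ->
  (forall v, p <= v <= q -> Num.sqrt (E - well v) <= C) ->
  `|Psi E (sg * Num.sqrt (well q)) - Psi E (sg * Num.sqrt (well p))| <= C * (q - p).
Proof.
move=> E02 sg2 p0; rewrite le_eqVlt => /predU1P[->|pq] sgP WP Wp Wq CP.
  by rewrite !subrr normr0 mulr0.
have E0 : 0 < E by case/andP: E02.
pose G v := Psi E (sg * Num.sqrt (well v)).
have GP v : p < v < q -> exists2 D, is_derive v 1 G D & `|D| <= Num.sqrt (E - well v).
  move=> vpq; apply: Psi_branch_derive => //; [|exact: WP|exact: sgP].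
  by case/andP: vpq => /(le_lt_trans p0).
pose dG v := 'D_1 G v.
have dGP v : v \in `]p, q[ -> is_derive v 1 G (dG v).
  by rewrite in_itv/= => /GP[D [dv _] _]; exact/derivableP.
have cSW : continuous (fun v => sg * Num.sqrt (well v)).
  move=> v; apply: cvgM; first exact: cvg_cst.
  apply: (@continuous_comp _ _ _ well Num.sqrt); [exact: continuous_well|exact: sqrt_continuous].
have cG : {within `[p, q], continuous G}.
  apply: (within_cont_comp (within_Psi E0)); first exact: within_cont.
  move=> v vpq; rewrite -ler_norml normrM.
  have -> : `|sg| = 1.
    by apply/eqP; rewrite -(@eqrXn2 _ 2)// expr1n real_normK ?num_real// sg2.
  rewrite mul1r ger0_norm ?sqrtr_ge0// ler_wsqrtr//.
  move: vpq => /andP[]; rewrite le_eqVlt => /predU1P[<-//|pv].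
  rewrite le_eqVlt => /predU1P[->//|vq].
  by apply/ltW/WP; rewrite pv.
have [c cpq ->] := MVT pq dGP cG.
move: cpq; rewrite in_itv/= => cpq; have /andP[pc cq] := cpq.
rewrite normrM [`|q - p|]ger0_norm ?subr_ge0 ?(ltW pq)//.
rewrite ler_wpM2r ?subr_ge0 ?(ltW pq)//.
have [D [_ dD] DC] := GP c cpq; rewrite /dG dD; apply: le_trans DC _.
by apply: CP; rewrite !ltW.
Qed.

(** [Phi] is [Psi] evaluated at y; the branches meet at 1, where y = 0. In place of a bound on the
    derivative stands an increment bound by any majorant C of the integrand, which adds up across
    the junction and includes the end points. *)
Lemma calibration m M : 0 <= m -> m < M -> well m = well M ->
  exists2 Phi : R -> R, Phi M - Phi m = well M * (pi / 2) &
    forall p q C, m <= p -> p <= q -> q <= M ->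
    (forall v, p <= v <= q -> Num.sqrt (well M - well v) <= C) ->
    `|Phi q - Phi p| <= C * (q - p).
Proof.
move=> m0 mM WmM; have [m1 M1 E0 E2 WP] := well_level m0 mM WmM.
have E02 : 0 < well M <= 2^-1 by rewrite E0.
have WP' v : m <= v <= M -> well v <= well M.
  move=> /andP[]; rewrite le_eqVlt => /predU1P[<-|mv]; first by rewrite WmM.
  by rewrite le_eqVlt => /predU1P[->//|vM]; apply/ltW/WP; rewrite mv.
pose Phi v := if v <= 1 then Psi (well M) (- 1 * Num.sqrt (well v))
  else Psi (well M) (1 * Num.sqrt (well v)).
have lo p q C : m <= p -> p <= q -> q <= 1 ->
    (forall v, p <= v <= q -> Num.sqrt (well M - well v) <= C) ->
    `|Phi q - Phi p| <= C * (q - p).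
  move=> mp pq q1 CP; rewrite /Phi q1 (le_trans pq q1).
  apply: Psi_branch_lip => //.
  - by rewrite sqrrN expr1n.
  - exact: le_trans mp.
  - by move=> v vpq; lra.
  - by move=> v vpq; apply: WP; lra.
  - by apply: WP'; lra.
  - by apply: WP'; lra.
have hi p q C : 1 <= p -> p <= q -> q <= M ->
    (forall v, p <= v <= q -> Num.sqrt (well M - well v) <= C) ->
    `|Phi q - Phi p| <= C * (q - p).
  have PhiE v : 1 <= v -> Phi v = Psi (well M) (1 * Num.sqrt (well v)).
    rewrite /Phi le_eqVlt => /predU1P[<-|v1].
      by rewrite lexx well1 sqrtr0 !mulr0.
    by rewrite leNgt v1.
  move=> p1 pq qM CP; rewrite !PhiE ?(le_trans p1 pq)//.
  apply: Psi_branch_lip => //.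
  - by rewrite expr1n.
  - by lra.
  - by move=> v vpq; lra.
  - by move=> v vpq; apply: WP; lra.
  - by apply: WP'; lra.
  - by apply: WP'; lra.
exists Phi.
  rewrite /Phi (ltW m1) leNgt M1/= mul1r mulN1r WmM; exact: Psi_total.
move=> p q C mp pq qM CP.
have [q1|q1] := leP q 1; first exact: lo.
have [p1|p1] := leP 1 p; first exact: hi.
have h1 : `|Phi q - Phi 1| <= C * (q - 1).
  by apply: hi => //; [lra|move=> v vv; apply: CP; lra].
have h2 : `|Phi 1 - Phi p| <= C * (1 - p).
  by apply: lo => //; [lra|move=> v vv; apply: CP; lra].
have := ler_normD (Phi q - Phi 1) (Phi 1 - Phi p); rewrite subrKA; lra.
Qed.

End calibrating_function.

(** * The first-order logarithmic Sobolev inequality *)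

Section log_sobolev.
Context {R : realType}.
Implicit Types (a b c d x y v E m M s t p q C L : R) (f g w S U Phi : R -> R).

Lemma within_comp_cont a b f g : continuous g -> {within `[a, b], continuous f} ->
  {within `[a, b], continuous (fun x => g (f x))}.
Proof.
move=> cg cf x; apply: (@continuous_comp (subspace `[a, b]) R R f g).
  exact: cf.
exact: cg.
Qed.

(** An integrated chain rule for [Phi] after [U] without derivatives. On a short interval S is
    nearly constant along U, so the increment of [Phi] is at most about S (U x) times that of U,
    itself bounded by the integral of [f]. *)
Lemma chain_le a b m M S U f Phi : a <= b ->
  continuous S -> (forall v, 0 <= S v) ->
  {within `[a, b], continuous U} -> (forall x, a <= x <= b -> m <= U x <= M) ->
  integ_on a b f -> (forall x, 0 <= f x) ->
  (forall s t, a <= s -> s <= t -> t <= b -> `|U t - U s| <= Rint s t f) ->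
  (forall p q C, m <= p -> p <= q -> q <= M ->
    (forall v, p <= v <= q -> S v <= C) -> `|Phi q - Phi p| <= C * (q - p)) ->
  `|Phi (U b) - Phi (U a)| <= Rint a b (fun x => S (U x) * f x).
Proof.
move=> ab cS S0 cU Ub fi f0 Uf PhiP.
have cSU := within_comp_cont cS cU.
have iSU : integ_on a b (fun x => S (U x) * f x) by exact: integ_contM.
have key e sg : 0 < e -> `|sg| = 1 ->
    sg * (Phi (U b) - Phi (U a)) <= Rint a b (fun x => S (U x) * f x) + e * Rint a b f.
  move=> e0 sg1.
  (* Near x, S stays within e / 2 of S (U x); the slack e covers this oscillation twice, once in the
     majorant C and once in the integrand. *)
  pose h x := (S (U x) + e) * f x.
  have hi : integ_on a b h.
    apply: integ_contM => // x; apply: cvgD; [exact: cSU|exact: cvg_cst].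
  suff : Rint a a h - sg * Phi (U a) <= Rint a b h - sg * Phi (U b).
    rewrite Rintxx (@Rint_eq _ a b h (fun x => S (U x) * f x + e * f x)); last first.
      by move=> x _; rewrite /h mulrDl.
    by rewrite RintD ?RintZ//; [lra|exact: integZ].
  apply: (@cousin_le _ (fun t => Rint a t h - sg * Phi (U t))) => // x xab.
  have e20 : 0 < e / 2 by rewrite divr_gt0.
  have /cvgrPdist_lt/(_ _ e20)/nbhs_ballP[rho /= rho0 Srho] := cS (U x).
  have [r r0 Ur] := within_contP cU xab rho0.
  exists r => // s t /andP[as_ sx] /andP[xt tb] sr tr.
  have st : s <= t by lra.
  have Uy y : s <= y <= t -> `|U y - U x| < rho.
    by move=> yst; apply: Ur; [lra|rewrite ltr_norml; lra].
  have hst : Rint a t h - Rint a s h = Rint s t h.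
    by apply: Rint_sub => //; apply: integ_sub hi; lra.
  pose C := S (U x) + e / 2.
  have SC v : `|v - U x| < rho -> S v <= C /\ S (U x) - e / 2 <= S v.
    move=> vr; have := Srho v; rewrite /ball/= distrC => /(_ vr).
    by rewrite ltr_norml /C; lra.
  have C0 : 0 <= C by rewrite /C addr_ge0// ltW.
  have U1 := Uy s; have U2 := Uy t; rewrite !lexx st in U1 U2.
  move/(_ isT) : U1; move/(_ isT) : U2; rewrite !ltr_norml => U2 U1.
  have PU : `|Phi (U t) - Phi (U s)| <= C * `|U t - U s|.
    have m1 := Ub s; have m2 := Ub t.
    have {}m1 : m <= U s <= M by apply: m1; lra.
    have {}m2 : m <= U t <= M by apply: m2; lra.
    have [UU|UU] := leP (U s) (U t).
      rewrite [`|U t - U s|]ger0_norm ?subr_ge0//; apply: PhiP; try lra.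
      by move=> v vst; have [] := SC v; rewrite // ltr_norml; lra.
    rewrite distrC [`|U t - U s|]distrC [`|U s - U t|]gtr0_norm ?subr_gt0//.
    apply: PhiP; try lra.
    by move=> v vst; have [] := SC v; rewrite // ltr_norml; lra.
  have Uft : `|U t - U s| <= Rint s t f by apply: Uf; lra.
  have CR : C * Rint s t f <= Rint s t h.
    rewrite -RintZ; last by apply: integ_sub fi; lra.
    apply: le_Rint; [apply: integZ; apply: integ_sub fi; lra|apply: integ_sub hi; lra|].
    move=> y yst; rewrite /h ler_wpM2r//; have [_] := SC _ (Uy y yst).
    by rewrite /C; lra.
  have : sg * (Phi (U t) - Phi (U s)) <= `|Phi (U t) - Phi (U s)|.
    by apply: le_trans (ler_norm _) _; rewrite normrM sg1 mul1r.
  have : C * `|U t - U s| <= C * Rint s t f by exact: ler_wpM2l.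
  lra.
have F0 : 0 <= Rint a b f by apply: Rint_ge0.
apply/ler_addgt0Pr => e e0.
have e1 : 0 < e / (Rint a b f + 1) by rewrite divr_gt0// ltr_wpDl.
have eF : e / (Rint a b f + 1) * Rint a b f <= e.
  by rewrite mulrAC ler_pdivrMr ?ltr_wpDl// ler_pM2l// lerDl.
have [d0|d0] := leP 0 (Phi (U b) - Phi (U a)).
  have := key _ 1 e1 (normr1 _); rewrite mul1r ger0_norm//; lra.
have := key _ (-1) e1 (normrN1 _); rewrite mulN1r ltr0_norm//; lra.
Qed.

(** The factor 2 counts the two arcs joining x and y, one of them passing through the identified
    points 0 and L. *)
Lemma loop_le L m M S U f Phi x y : 0 <= x <= L -> 0 <= y <= L ->
  continuous S -> (forall v, 0 <= S v) ->
  {within `[0, L], continuous U} -> (forall x, 0 <= x <= L -> m <= U x <= M) ->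
  U 0 = U L ->
  integ_on 0 L f -> (forall x, 0 <= f x) ->
  (forall s t, 0 <= s -> s <= t -> t <= L -> `|U t - U s| <= Rint s t f) ->
  (forall p q C, m <= p -> p <= q -> q <= M ->
    (forall v, p <= v <= q -> S v <= C) -> `|Phi q - Phi p| <= C * (q - p)) ->
  2 * `|Phi (U x) - Phi (U y)| <= Rint 0 L (fun x => S (U x) * f x).
Proof.
move=> xL yL cS S0 cU Ub U0L fi f0 Uf PhiP.
wlog xy : x y xL yL / x <= y.
  by move=> H; have [xy|/ltW yx] := leP x y; [|rewrite distrC]; exact: H.
have iSU : integ_on 0 L (fun x => S (U x) * f x).
  by apply: integ_contM => //; exact: within_comp_cont.
have arc s t : 0 <= s -> s <= t -> t <= L ->
    `|Phi (U t) - Phi (U s)| <= Rint s t (fun x => S (U x) * f x).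
  move=> s0 st tL; apply: (@chain_le s t m M) => //.
  - by apply: continuous_subspaceW cU; apply: subset_itvScc; rewrite bnd_simp.
  - by move=> z zst; apply: Ub; lra.
  - exact: integ_sub fi.
  - by move=> s' t' *; apply: Uf; lra.
rewrite (@Rint_split _ 0 L x)//.
rewrite (@Rint_split _ x L y); [|lra|by apply: integ_sub iSU; lra].
have h1 : `|Phi (U L) - Phi (U y)| <= Rint y L (fun x => S (U x) * f x) by apply: arc; lra.
have h2 : `|Phi (U y) - Phi (U x)| <= Rint x y (fun x => S (U x) * f x) by apply: arc; lra.
have h3 : `|Phi (U x) - Phi (U 0)| <= Rint 0 x (fun x => S (U x) * f x) by apply: arc; lra.
rewrite -U0L in h1.
have : `|Phi (U x) - Phi (U y)| <= `|Phi (U x) - Phi (U 0)| + `|Phi (U 0) - Phi (U y)|.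
  exact: ler_distD.
by rewrite distrC in h2; lra.
Qed.

Lemma well_rescale m M : 0 <= m -> m < M -> exists2 l, 0 < l & well (l * m) = well (l * M).
Proof.
move=> m0 mM; have D0 : 0 < M ^+ 2 - m ^+ 2 by nra.
(* Equality of the two levels is a linear equation in k = ln (l^2), because the logarithm of (l v)^2
   splits; this is its solution. *)
pose k := (M ^+ 2 - m ^+ 2 - M ^+ 2 * ln (M ^+ 2) + m ^+ 2 * ln (m ^+ 2))
  / (M ^+ 2 - m ^+ 2).
exists (expR (k / 2)); first exact: expR_gt0.
set l := expR (k / 2); have l0 : 0 < l by exact: expR_gt0.
have ll : ln (l ^+ 2) = k by rewrite lnXn// expRK mulr2n -splitr.
have WE v : 0 <= v -> well (l * v) = (l ^+ 2 * (v ^+ 2 * k + v ^+ 2 * ln (v ^+ 2)) - l ^+ 2 * v ^+ 2 + 1) / 2.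
  rewrite /well exprMn le_eqVlt => /predU1P[<-|v0]; first by rewrite expr0n/= !(mulr0, mul0r) addr0 mulr0.
  by rewrite lnM ?posrE ?exprn_gt0// ll; ring.
rewrite !WE//; last by rewrite (le_trans m0)// ltW.
have : k * (M ^+ 2 - m ^+ 2) = M ^+ 2 - m ^+ 2 - M ^+ 2 * ln (M ^+ 2) + m ^+ 2 * ln (m ^+ 2).
  by rewrite /k divfK// gt_eqF.
move=> E; congr (_ / 2); congr (_ + 1).
rewrite -!mulrBr; congr (_ * _); lra.
Qed.

Lemma circle_L2norm_sqr L (u : R -> R) : 0 < L ->
  circle_L2norm L u ^+ 2 = L^-1 * Rint 0 L (fun x => u x ^+ 2).
Proof.
move=> L0; rewrite /circle_L2norm sqr_sqrtr// mulr_ge0 ?invr_ge0 ?(ltW L0)//.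
by apply: Rint_ge0 => x _; exact: sqr_ge0.
Qed.

Lemma sqr_ln_split (u N l : R) : 0 < N -> 0 < l ->
  (l * u) ^+ 2 * ln ((l * u) ^+ 2) =
  l ^+ 2 * (u ^+ 2 * ln (u ^+ 2 / N)) + l ^+ 2 * ln (l ^+ 2 * N) * u ^+ 2.
Proof.
move=> N0 l0; have [->|u0] := eqVneq u 0; first by rewrite mulr0 expr0n/= !(mul0r, mulr0) addr0.
have u20 : 0 < u ^+ 2 by rewrite lt_neqAle sqr_ge0 eq_sym sqrf_eq0 u0.
have l20 : 0 < l ^+ 2 by rewrite exprn_gt0.
rewrite exprMn ln_div ?posrE//.
have -> : ln (l ^+ 2 * u ^+ 2) = ln (l ^+ 2) + ln (u ^+ 2) by rewrite lnM ?posrE.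
have -> : ln (l ^+ 2 * N) = ln (l ^+ 2) + ln N by rewrite lnM ?posrE.
by ring.
Qed.

Lemma continuous_sqr_ln N : continuous (fun v : R => v ^+ 2 * ln (v ^+ 2 / N)).
Proof.
(* For N = 0 the quotient is 0 by convention, hence so is its logarithm, and the function vanishes
   identically. *)
have [->|N0] := eqVneq N 0.
  have -> : (fun v : R => v ^+ 2 * ln (v ^+ 2 / 0)) = (fun _ : R => 0).
    by apply/funext => v; rewrite invr0 mulr0 ln0 ?mulr0.
  exact: cst_continuous.
have -> : (fun v : R => v ^+ 2 * ln (v ^+ 2 / N)) =
  (fun v => N * ((fun x : R => x * ln x) (v ^+ 2 / N))).
  by apply/funext => v; rewrite mulrA mulrCA divff// mulr1.
apply: contM; first exact: cst_continuous.
move=> v; apply: (@continuous_comp _ _ _ (fun v : R => v ^+ 2 / N) (fun x : R => x * ln x)).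
  apply: contM; last exact: cst_continuous.
  by move=> z; exact: exprn_continuous.
exact: continuous_xlnx.
Qed.

Lemma within_entropy L (u : R -> R) N : {within `[0, L], continuous u} ->
  {within `[0, L], continuous (fun x => u x ^+ 2 * ln (u x ^+ 2 / N))}.
Proof. exact: (@within_comp_cont _ _ u _ (@continuous_sqr_ln N)). Qed.

(** [f] merely controls the increments of [w]: it can be the modulus of a weak derivative, and it
    scales with [w] when the inequality is linearised. *)
Lemma log_sobolev L w f : 0 < L -> {within `[0, L], continuous w} -> w 0 = w L ->
  integ_on 0 L f -> integ_on 0 L (fun x => f x ^+ 2) -> (forall x, 0 <= f x) ->
  (forall s t, 0 <= s -> s <= t -> t <= L -> `|w t - w s| <= Rint s t f) ->
  (2 * pi / L) ^+ 2 / 2 * entropy L w <= Rint 0 L (fun x => f x ^+ 2).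
Proof.
move=> L0 cw w0L fi f2 f0 wf.
set N := circle_L2norm L w ^+ 2.
have NE : N * L = Rint 0 L (fun x => w x ^+ 2).
  by rewrite /N circle_L2norm_sqr// mulrAC mulVf ?mul1r// gt_eqF.
have Ff : 0 <= Rint 0 L (fun x => f x ^+ 2) by apply: Rint_ge0 => x _; exact: sqr_ge0.
have entE : entropy L w = Rint 0 L (fun x => w x ^+ 2 * ln (w x ^+ 2 / N)) by [].
have ent0 : (forall x, 0 <= x <= L -> w x ^+ 2 * ln (w x ^+ 2 / N) = 0) ->
    entropy L w = 0.
  move=> H; rewrite entE (@Rint_eq _ _ _ _ (cst 0)); last by move=> x /H.
  by rewrite Rint_cst ?mul0r// ltW.
have := sqr_ge0 (circle_L2norm L w); rewrite -/N le_eqVlt => /predU1P[N0|N0].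
  by rewrite ent0 ?mulr0// => x _; rewrite -N0 invr0 mulr0 ln0// mulr0.
(* The modulus preserves the entropy, does not enlarge increments, and moves the range to the
   half-line on which the well has a single minimum. *)
pose U x := `|w x|.
have cU : {within `[0, L], continuous U}.
  by apply: (@within_comp_cont _ _ _ (fun v : R => `|v|)) => //; exact: norm_continuous.
have [xM xML UM] := EVT_max (ltW L0) cU.
have [xm xmL Um] := EVT_min (ltW L0) cU.
set M := U xM in UM; set m := U xm in Um.
have Ub x : 0 <= x <= L -> m <= U x <= M by move=> xL; rewrite Um ?UM// in_itv.
rewrite in_itv/= in xML; rewrite in_itv/= in xmL.
have m0 : 0 <= m by exact: normr_ge0.
have : m <= M by have /andP[] := Ub _ xML.
(* A constant modulus gives zero entropy and is set apart: the calibration needs a nondegenerate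
   range. *)
rewrite le_eqVlt => /predU1P[mM|mM].
  have wE x : 0 <= x <= L -> w x ^+ 2 = M ^+ 2.
    move=> /Ub; rewrite mM -eq_le => /eqP->.
    by rewrite /U real_normK ?num_real.
  have NM : N = M ^+ 2.
    apply: (@mulIf _ L); first by rewrite gt_eqF.
    rewrite NE (Rint_eq wE) -[fun x => _]/(cst (M ^+ 2)) Rint_cst ?subr0//.
    exact: ltW.
  rewrite ent0 ?mulr0// => x xL; rewrite wE// -NM divff ?gt_eqF// ln1 mulr0//.
have [l l0 lW] := well_rescale m0 mM.
have lmM : l * m < l * M by rewrite ltr_pM2l.
have lm0 : 0 <= l * m by rewrite mulr_ge0// ltW.
have [Phi PhiMm PhiP] := calibration lm0 lmM lW.
set E := well (l * M) in PhiMm PhiP.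
pose S v := Num.sqrt (E - well v).
have cS : continuous S.
  move=> v; apply: (@continuous_comp _ _ _ (fun v => E - well v) Num.sqrt); last exact: sqrt_continuous.
  by apply: (continuousB (@cst_continuous _ _ E v)); exact: continuous_well.
have S0 v : 0 <= S v by exact: sqrtr_ge0.
pose lU x := l * U x.
have clU : {within `[0, L], continuous lU}.
  by apply: within_contM => //; apply: within_cont; exact: cst_continuous.
have lUb x : 0 <= x <= L -> l * m <= lU x <= l * M.
  by move=> /Ub /andP[? ?]; rewrite !ler_pM2l//; apply/andP.
have lfi : integ_on 0 L (fun x => l * f x) by exact: integZ.
have loop := @loop_le L (l * m) (l * M) S lU (fun x => l * f x) Phi xM xm
  xML xmL cS S0 clU lUb _ lfi.
have {}loop : 2 * `|Phi (lU xM) - Phi (lU xm)| <= Rint 0 L (fun x => S (lU x) * (l * f x)).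
  apply: loop => //.
  - by rewrite /lU /U w0L.
  - by move=> x; rewrite mulr_ge0// ltW.
  - move=> s t s0 st tL; rewrite RintZ; last exact: integ_sub fi.
    rewrite /lU -mulrBr normrM gtr0_norm// ler_pM2l//.
    by apply: le_trans (wf s t s0 st tL); exact: ler_dist_dist.
have WE x : 0 <= x <= L -> S (lU x) ^+ 2 = E - well (lU x).
  move=> /lUb /andP[a1 a2]; rewrite sqr_sqrtr// subr_ge0.
  have [_ _ _ _ WP] := well_level lm0 lmM lW.
  move: a1; rewrite le_eqVlt => /predU1P[<-|a1]; first by rewrite lW.
  move: a2; rewrite le_eqVlt => /predU1P[->//|a2].
  by apply/ltW/WP; rewrite a1.
have cWU := within_comp_cont (@continuous_well R) clU.
have iW : integ_on 0 L (fun x => well (lU x)) by exact: integ_cont.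
pose om := 2 * pi / L.
have om0 : 0 < om by rewrite divr_gt0 ?mulr_gt0 ?pi_gt0.
have omL : om * L = 2 * pi by rewrite divfK// gt_eqF.
have i1 : integ_on 0 L (fun x => S (lU x) * (l * f x)).
  by apply: integ_contM => //; exact: within_comp_cont.
have main : om ^+ 2 * Rint 0 L (fun x => well (lU x)) <= l ^+ 2 * Rint 0 L (fun x => f x ^+ 2).
  have : Rint 0 L (fun x => (2 * om) * (S (lU x) * (l * f x)) - om ^+ 2 * (E - well (lU x)))
    <= Rint 0 L (fun x => l ^+ 2 * f x ^+ 2).
    apply: le_Rint; last first.
    - move=> x xL; rewrite -WE// -subr_ge0.
      rewrite (_ : _ - _ = (l * f x - om * S (lU x)) ^+ 2) ?sqr_ge0//; ring.
    - exact: integZ.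
    - apply: integB; first exact: integZ.
      by apply: integZ; apply: integB => //; exact: integ_cst.
  rewrite RintB; [|exact: integZ|by apply: integZ; apply: integB => //; exact: integ_cst].
  rewrite !RintZ//; last by apply: integB => //; exact: integ_cst.
  rewrite RintB//; last exact: integ_cst.
  rewrite -[fun x => E]/(cst E) Rint_cst ?(ltW L0)// subr0.
  have : E * (pi / 2) <= `|Phi (lU xM) - Phi (lU xm)|.
    by rewrite -PhiMm; exact: ler_norm.
  set I1 := Rint 0 L (fun x => S _ * _) in loop *.
  move=> e1; have e2 : E * pi <= I1 by lra.
  have : om * (E * pi) <= om * I1 by rewrite ler_pM2l.
  (* Since om L = 2 pi, the level term om^2 E L is exactly 2 om times the calibrated amount E pi and
     cancels. This is where the sharp frequency enters. *)
  have -> : om ^+ 2 * (E * L - Rint 0 L (fun x => well (lU x))) =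
    om * E * (om * L) - om ^+ 2 * Rint 0 L (fun x => well (lU x)) by ring.
  rewrite omL; lra.
have ce := @within_entropy L w N cw.
have ie : integ_on 0 L (fun x => w x ^+ 2 * ln (w x ^+ 2 / N)) by exact: integ_cont.
have iw2 : integ_on 0 L (fun x => w x ^+ 2).
  apply: integ_cont; apply: (@within_comp_cont _ _ _ (fun v => v ^+ 2)) => //.
  by move=> v; exact: exprn_continuous.
pose rho := l ^+ 2 * N.
have rho0 : 0 < rho by rewrite mulr_gt0// exprn_gt0.
have WI : Rint 0 L (fun x => well (lU x)) =
    (l ^+ 2 * entropy L w + L * (rho * ln rho - rho + 1)) / 2.
  transitivity (Rint 0 L (fun x => l ^+ 2 / 2 * (w x ^+ 2 * ln (w x ^+ 2 / N)) +
     (l ^+ 2 * (ln rho - 1) / 2 * w x ^+ 2 + 2^-1))).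
    apply: Rint_eq => x xL; rewrite /well.
    have -> : lU x ^+ 2 = (l * w x) ^+ 2 by rewrite /lU /U !exprMn real_normK ?num_real.
    by rewrite (sqr_ln_split _ N0 l0) exprMn; field.
  rewrite RintD; [|exact: integZ|by apply: integD; [exact: integZ|exact: integ_cst]].
  rewrite RintZ// RintD; [|exact: integZ|exact: integ_cst].
  rewrite RintZ// -NE -[fun x => 2^-1]/(cst 2^-1) Rint_cst ?(ltW L0)// -entE.
  by rewrite /rho; field.
have l20 : 0 < l ^+ 2 by rewrite exprn_gt0.
rewrite -(ler_pM2l l20); apply: le_trans main.
rewrite WI -/om.
have := xlnx_ge rho0; move=> xr.
have : 0 <= om ^+ 2 * (L * (rho * ln rho - rho + 1)).
  by rewrite mulr_ge0 ?sqr_ge0// mulr_ge0 ?(ltW L0)//; lra.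
nra.
Qed.

End log_sobolev.

(** * Second-order expansion of the entropy and its consequences *)

Section linearization.
Context {R : realType}.
Implicit Types (a b c d x y v e m M s t p q B C L : R) (f g h w u : R -> R).

Lemma ln1D_ge t : `|t| < 2^-1 -> t - t ^+ 2 / 2 - `|t| ^+ 3 <= ln (1 + t).
Proof.
move=> t2; have := t2; rewrite ltr_norml => /andP[tl tr].
(* The quartic Taylor coefficient -1/4 is lowered to -1/2, so that the derivative factors as (x -
   1)^3 (2 x - 1) / x and has the sign of x - 1 beyond 1/2. *)
pose f x := ln x - ((x - 1) - (x - 1) ^+ 2 / 2 + (x - 1) ^+ 3 / 3 - (x - 1) ^+ 4 / 2).
pose df x := x^-1 * (x - 1) ^+ 3 * (2 * x - 1).
have : f 1 <= f (1 + t).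
  apply: (@le_of_derive_sign _ 2^-1 f df); [lra|lra| |].
    move=> x x2; have x0 : 0 < x by lra.
    have hl := is_derive1_ln x0.
    have h1 : is_derive x 1 (fun x => x - 1) 1.
      by apply: is_derive1_eq (is_deriveB (is_derive_id x (1 : R)) (is_derive_cst (1 : R) x 1));
        rewrite subr0.
    have h2 := is_deriveM h1 h1.
    have h3 := is_deriveM h2 h1.
    have h4 := is_deriveM h3 h1.
    have h := is_deriveB hl (is_deriveB (is_deriveD (is_deriveB h1 (is_deriveZ 2^-1 h2)) (is_deriveZ 3^-1 h3)) (is_deriveZ 2^-1 h4)).
    have fE : f = (fun x => ln x - (((x - 1) - 2^-1 * ((x - 1) * (x - 1))) + 3^-1 * ((x - 1) * (x - 1) * (x - 1)) - 2^-1 * ((x - 1) * (x - 1) * (x - 1) * (x - 1)))).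
      by apply/funext => y; rewrite /f; field.
    rewrite fE; apply: is_derive1_eq h.
    rewrite !fctE /GRing.scale/= /df; field; rewrite gt_eqF//.
  move=> x x2; have xi : 0 < x^-1 by rewrite invr_gt0; lra.
  have -> : (x - 1) * df x = x^-1 * ((x - 1) ^+ 2) ^+ 2 * (2 * x - 1) by rewrite /df; ring.
  apply: mulr_ge0; first by apply: mulr_ge0; [exact: ltW|exact: sqr_ge0].
  lra.
have -> : f 1 = 0 by rewrite /f ln1 subrr; field.
have -> : f (1 + t) = ln (1 + t) - (t - t ^+ 2 / 2 + t ^+ 3 / 3 - t ^+ 4 / 2).
  by rewrite /f (_ : 1 + t - 1 = t)//; ring.
move=> fP.
suff : - `|t| ^+ 3 <= t ^+ 3 / 3 - t ^+ 4 / 2 by lra.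
have t3 : - `|t| ^+ 3 <= t ^+ 3 by rewrite -normrX lerNl -normrN ler_norm.
have t4 : t ^+ 4 <= `|t| ^+ 3 / 2.
  have -> : t ^+ 4 = `|t| ^+ 3 * `|t|.
    by rewrite -exprSr -normrX ger0_norm// -[4%N]/(2 * 2)%N exprM sqr_ge0.
  by rewrite ler_wpM2l ?exprn_ge0// ltW.
have : 0 <= `|t| ^+ 3 by rewrite exprn_ge0.
lra.
Qed.

(** The constant 5 is 9/2 + 1/2: the cubic error of the logarithm is multiplied by 2 (1 + t)^2 <=
    9/2, and the quartic term is at most |t|^3 / 2. *)
Lemma sqr_ln1D_ge t B : `|t| <= B -> B < 2^-1 ->
  2 * t + 3 * t ^+ 2 - 5 * B * t ^+ 2 <= (1 + t) ^+ 2 * (2 * ln (1 + t)).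
Proof.
move=> tB B2; have t2 : `|t| < 2^-1 by exact: le_lt_trans B2.
have := t2; rewrite ltr_norml => /andP[tl tr].
have n0 : 0 <= `|t| by [].
have l := ln1D_ge t2.
have s0 : 0 <= 2 * (1 + t) ^+ 2 by rewrite mulr_ge0 ?sqr_ge0.
have := ler_wpM2l s0 l.
have tt : t ^+ 2 = `|t| ^+ 2 by rewrite real_normK ?num_real.
have t3 : `|t| ^+ 3 = `|t| * t ^+ 2 by rewrite tt -exprS.
have c3 : `|t| * t ^+ 2 <= B * t ^+ 2 by rewrite ler_wpM2r ?sqr_ge0.
rewrite t3.
have h1 : 2 * (1 + t) ^+ 2 * (`|t| * t ^+ 2) <= 9 / 2 * (`|t| * t ^+ 2).
  apply: ler_wpM2r; first by rewrite mulr_ge0 ?sqr_ge0.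
  have q1 : (1 + t) ^+ 2 <= (3 / 2) ^+ 2.
    by rewrite ler_pXn2r ?nnegrE//; lra.
  lra.
have h2 : t ^+ 2 * t ^+ 2 <= 2^-1 * (`|t| * t ^+ 2).
  rewrite [leRHS]mulrA; apply: ler_wpM2r; first exact: sqr_ge0.
  by rewrite tt expr2; apply: ler_wpM2r => //; exact: ltW.
have -> : 2 * (1 + t) ^+ 2 * (t - t ^+ 2 / 2 - `|t| * t ^+ 2) =
  2 * t + 3 * t ^+ 2 - t ^+ 2 * t ^+ 2 - 2 * (1 + t) ^+ 2 * (`|t| * t ^+ 2) by field.
lra.
Qed.

(** The linear term integrates to zero. In units of e^2 times the integral of f^2, the pointwise
    bound contributes 3 - 5 e B and the normalisation by N costs at most 1 + e B, which leaves 2 (1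
    - 3 e B). The estimate serves both the Poincare inequality and sharpness. *)
Lemma entropy_expansion L f e B : 0 < L -> {within `[0, L], continuous f} ->
  (forall x, 0 <= x <= L -> `|f x| <= B) -> 0 < e -> e * B < 2^-1 ->
  Rint 0 L f = 0 ->
  2 * e ^+ 2 * Rint 0 L (fun x => f x ^+ 2) * (1 - 3 * (e * B)) <=
  entropy L (fun x => 1 + e * f x).
Proof.
move=> L0 cf fB e0 eB f0.
have B0 : 0 <= B by apply: le_trans (fB 0 _) => //; rewrite lexx ltW.
have fi : integ_on 0 L f by exact: integ_cont.
have csq : {within `[0, L], continuous (fun x => f x ^+ 2)}.
  by apply: (@within_comp_cont _ _ _ _ (fun v => v ^+ 2)) => // v; exact: exprn_continuous.
have f2 : integ_on 0 L (fun x => f x ^+ 2) by exact: integ_cont.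
set Q := Rint 0 L (fun x => f x ^+ 2).
have Q0 : 0 <= Q by apply: Rint_ge0 => x _; exact: sqr_ge0.
have QB : Q <= B ^+ 2 * L.
  rewrite -[L in leRHS]subr0 -Rint_cst ?(ltW L0)//.
  apply: le_Rint => //; first exact: integ_cst.
  by move=> x /fB xB; rewrite -(real_normK (num_real _)) ler_pXn2r ?nnegrE.
pose u x := 1 + e * f x.
have cu : {within `[0, L], continuous u}.
  apply: (@within_comp_cont _ _ _ _ (fun v => 1 + e * v)) => //.
  apply: contD; first exact: cst_continuous.
  by apply: contM; [exact: cst_continuous|move=> v; exact: cvg_id].
set N := circle_L2norm L u ^+ 2.
have u2 : Rint 0 L (fun x => u x ^+ 2) = L + e ^+ 2 * Q.
  transitivity (Rint 0 L (fun x => 1 + (2 * e * f x + e ^+ 2 * f x ^+ 2))).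
    by apply: Rint_eq => x _; rewrite /u; ring.
  rewrite RintD; [|exact: integ_cst|by apply: integD; exact: integZ].
  rewrite RintD; [|exact: integZ..].
  rewrite !RintZ// f0 -/Q -[fun x => 1]/(cst 1) Rint_cst ?(ltW L0)//; ring.
have NE : N = 1 + e ^+ 2 * (Q / L).
  by rewrite /N circle_L2norm_sqr// u2; field; rewrite gt_eqF.
have q0 : 0 <= e ^+ 2 * (Q / L) by rewrite mulr_ge0 ?sqr_ge0// divr_ge0// ltW.
have N0 : 0 < N by rewrite NE; lra.
have lnN : ln N <= e ^+ 2 * (Q / L) by rewrite NE; apply: le_ln1Dx; lra.
have tB x : 0 <= x <= L -> `|e * f x| <= e * B.
  by move=> /fB; rewrite normrM gtr0_norm// ler_pM2l.
have u0 x : 0 <= x <= L -> 0 < u x.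
  by move=> /tB; rewrite ler_norml /u; lra.
have iE : integ_on 0 L (fun x => u x ^+ 2 * ln (u x ^+ 2 / N)).
  by apply: integ_cont; exact: within_entropy.
have iu : integ_on 0 L (fun x => u x ^+ 2).
  by apply: integ_cont; apply: (@within_comp_cont _ _ _ _ (fun v => v ^+ 2)) => // v; exact: exprn_continuous.
have entE : entropy L u = Rint 0 L (fun x => u x ^+ 2 * ln (u x ^+ 2 / N)) by [].
pose low x := 2 * e * f x + (3 - 5 * (e * B)) * e ^+ 2 * f x ^+ 2 - ln N * u x ^+ 2.
have ilow : integ_on 0 L low.
  by apply: integB; [apply: integD|]; exact: integZ.
have : Rint 0 L low <= entropy L u.
  rewrite entE; apply: le_Rint => // x xL.
  have ux := u0 x xL.
  have ux2 : 0 < u x ^+ 2 by rewrite exprn_gt0.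
  rewrite ln_div ?posrE// lnXn// -mulr_natl.
  have := sqr_ln1D_ge (tB x xL) eB; rewrite -/(u x) /low.
  rewrite exprMn; lra.
rewrite /low RintB; [|by apply: integD; exact: integZ|exact: integZ].
rewrite RintD; [|exact: integZ..].
rewrite !RintZ// f0 u2 -/Q mulr0 add0r => h.
apply: le_trans h.
have P0 : 0 <= L + e ^+ 2 * Q by rewrite addr_ge0 ?(ltW L0)// mulr_ge0 ?sqr_ge0.
have k1 : ln N * (L + e ^+ 2 * Q) <= e ^+ 2 * (Q / L) * (L + e ^+ 2 * Q).
  exact: ler_wpM2r.
have k2 : e ^+ 2 * (Q / L) * (L + e ^+ 2 * Q) = e ^+ 2 * Q + e ^+ 2 * Q * (e ^+ 2 * (Q / L)).
  by field; rewrite gt_eqF.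
have k3 : e ^+ 2 * (Q / L) <= e * B.
  apply: (@le_trans _ _ (e ^+ 2 * B ^+ 2)).
    by rewrite ler_wpM2l ?sqr_ge0// ler_pdivrMr.
  have : 0 <= e * B by rewrite mulr_ge0// ltW.
  by rewrite -exprMn; nra.
have k4 : e ^+ 2 * Q * (e ^+ 2 * (Q / L)) <= e ^+ 2 * Q * (e * B).
  by apply: ler_wpM2l => //; rewrite mulr_ge0 ?sqr_ge0.
lra.
Qed.

Lemma poincare L w f : 0 < L -> {within `[0, L], continuous w} -> w 0 = w L ->
  Rint 0 L w = 0 ->
  integ_on 0 L f -> integ_on 0 L (fun x => f x ^+ 2) -> (forall x, 0 <= f x) ->
  (forall s t, 0 <= s -> s <= t -> t <= L -> `|w t - w s| <= Rint s t f) ->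
  (2 * pi / L) ^+ 2 * Rint 0 L (fun x => w x ^+ 2) <= Rint 0 L (fun x => f x ^+ 2).
Proof.
move=> L0 cw w0L wm fi f2 f0 wf.
have cU : {within `[0, L], continuous (fun x => `|w x|)}.
  by apply: (@within_comp_cont _ _ _ _ (fun v : R => `|v|)) => //; exact: norm_continuous.
have [xM _ UM] := EVT_max (ltW L0) cU.
pose B := `|w xM| + 1.
have B0 : 0 < B by rewrite ltr_wpDl.
have wB x : 0 <= x <= L -> `|w x| <= B.
  by move=> xL; have := UM x; rewrite in_itv/= => /(_ xL); rewrite /B; lra.
set Q := Rint 0 L (fun x => w x ^+ 2); set F := Rint 0 L (fun x => f x ^+ 2).
set k := (2 * pi / L) ^+ 2.
have k0 : 0 <= k by exact: sqr_ge0.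
have Q0 : 0 <= Q by apply: Rint_ge0 => x _; exact: sqr_ge0.
have key e : 0 < e -> e * B < 2^-1 -> k * Q * (1 - 3 * (e * B)) <= F.
  move=> e0 eB.
  have ent := entropy_expansion L0 cw wB e0 eB wm.
  have ce : {within `[0, L], continuous (fun x => 1 + e * w x)}.
    apply: (@within_comp_cont _ _ _ _ (fun v => 1 + e * v)) => //.
    apply: contD; first exact: cst_continuous.
    by apply: contM; [exact: cst_continuous|move=> v; exact: cvg_id].
  have := @log_sobolev _ L (fun x => 1 + e * w x) (fun x => e * f x) L0 ce.
  rewrite w0L => /(_ erefl (integZ e fi)).
  have i2 : integ_on 0 L (fun x => (e * f x) ^+ 2).
    by apply: (@integ_eq _ _ _ (fun x => e ^+ 2 * f x ^+ 2)) => [x _|]; [rewrite exprMn|exact: integZ].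
  move=> /(_ i2) ls.
  have : (2 * pi / L) ^+ 2 / 2 * entropy L (fun x => 1 + e * w x) <= Rint 0 L (fun x => (e * f x) ^+ 2).
    apply: ls => [x|s t s0 st tL]; first by rewrite mulr_ge0// ltW.
    rewrite RintZ; last exact: integ_sub fi.
    rewrite (_ : _ - _ = e * (w t - w s)); last by ring.
    by rewrite normrM gtr0_norm// ler_pM2l// wf.
  rewrite (@Rint_eq _ _ _ _ (fun x => e ^+ 2 * f x ^+ 2)); last by move=> x _; rewrite exprMn.
  rewrite RintZ// -/F -/k => le1.
  have e20 : 0 < e ^+ 2 by rewrite exprn_gt0.
  rewrite -(ler_pM2l e20); apply: le_trans le1.
  have : k / 2 * (2 * e ^+ 2 * Q * (1 - 3 * (e * B))) <= k / 2 * entropy L (fun x => 1 + e * w x).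
    by apply: ler_wpM2l => //; rewrite divr_ge0.
  lra.
rewrite leNgt; apply/negP => FQ.
have kQ : 0 < k * Q by apply: le_lt_trans FQ; apply: Rint_ge0 => x _; exact: sqr_ge0.
(* The value of e B for which the loss 3 d uses up half of the supposed relative gap between k Q and
   F. *)
pose d := (k * Q - F) / (k * Q) / 6.
have F0 : 0 <= F by apply: Rint_ge0 => x _; exact: sqr_ge0.
have d0 : 0 < d by rewrite !divr_gt0// subr_gt0.
have d6 : d <= 6^-1.
  by rewrite /d ler_pdivrMr// mulVf// ler_pdivrMr// mul1r; lra.
have := key (d / B); rewrite divfK ?gt_eqF// divr_gt0// => /(_ isT).
have -> : k * Q * (1 - 3 * d) = k * Q - (k * Q - F) / 2.
  by rewrite /d; field; move: kQ; rewrite lt_neqAle eq_sym mulf_eq0 negb_or => /andP[/andP[-> ->]].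
move=> /(_ _); have -> : (d < 2^-1) = true by lra.
by move=> /(_ isT); lra.
Qed.

Lemma cont_Rint_eq0 L f : 0 < L -> {within `[0, L], continuous f} ->
  (forall x, 0 <= x <= L -> 0 <= f x) -> Rint 0 L f <= 0 ->
  forall x, 0 <= x <= L -> f x = 0.
Proof.
move=> L0 cf f0 If x xL; apply/eqP; rewrite eq_le f0// andbT leNgt; apply/negP => fx.
have fi : integ_on 0 L f by exact: integ_cont.
have fx2 : 0 < f x / 2 by rewrite divr_gt0.
have [r r0 rP] := within_contP cf xL fx2.
pose p := Num.max 0 (x - r / 2); pose q := Num.min L (x + r / 2).
have p0 : 0 <= p by rewrite le_max lexx.
have px : x - r / 2 <= p by rewrite le_max lexx orbT.
have qL : q <= L by rewrite ge_min lexx.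
have qx : q <= x + r / 2 by rewrite ge_min lexx orbT.
have pq : p < q.
  by rewrite gt_max !lt_min; apply/andP; split; apply/andP; split; lra.
have ip : integ_on p q f by apply: integ_sub fi; lra.
have : Rint p q (cst (f x / 2)) <= Rint p q f.
  apply: le_Rint => //; first exact: integ_cst.
  move=> y ypq; have yL : 0 <= y <= L by lra.
  have yr : `|y - x| < r by rewrite ltr_norml; lra.
  by have := rP y yL yr; rewrite ltr_norml /cst; lra.
rewrite Rint_cst ?(ltW pq)// => h1.
have h2 : 0 < f x / 2 * (q - p) by rewrite mulr_gt0 ?subr_gt0.
move: If; rewrite (@Rint_split _ 0 L p)//; last by lra.
rewrite (@Rint_split _ p L q); [|lra|by apply: integ_sub fi; lra].
have : 0 <= Rint 0 p f by apply: Rint_ge0 => y ?; apply: f0; lra.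
have : 0 <= Rint q L f by apply: Rint_ge0 => y ?; apply: f0; lra.
lra.
Qed.

(** Scaled so that the mean square is 1, the entropy is twice the integral of the well, up to a
    positive factor. It can be nonpositive only if the well vanishes along [w], which fixes the
    modulus; continuity then fixes the sign. *)
Lemma entropy_le0_cst L w : 0 < L -> {within `[0, L], continuous w} ->
  entropy L w <= 0 -> forall x, 0 <= x <= L -> w x = w 0.
Proof.
move=> L0 cw; set N := circle_L2norm L w ^+ 2.
have entE : entropy L w = Rint 0 L (fun x => w x ^+ 2 * ln (w x ^+ 2 / N)) by [].
have c2 : {within `[0, L], continuous (fun x => w x ^+ 2)}.
  by apply: (@within_comp_cont _ _ _ _ (fun v => v ^+ 2)) => // v; exact: exprn_continuous.
have i2 : integ_on 0 L (fun x => w x ^+ 2) by exact: integ_cont.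
have NE : N * L = Rint 0 L (fun x => w x ^+ 2).
  by rewrite /N circle_L2norm_sqr// mulrAC mulVf ?mul1r// gt_eqF.
have ie : integ_on 0 L (fun x => w x ^+ 2 * ln (w x ^+ 2 / N)).
  by apply: integ_cont; exact: within_entropy.
move=> ent0.
have w2 : forall x, 0 <= x <= L -> w x ^+ 2 = N.
  have := sqr_ge0 (circle_L2norm L w); rewrite -/N le_eqVlt => /predU1P[N0|N0].
    rewrite -N0; apply: (@cont_Rint_eq0 L (fun x => w x ^+ 2)) => //.
      by move=> y _; exact: sqr_ge0.
    by rewrite -NE -N0 mul0r.
  pose l := (Num.sqrt N)^-1.
  have sN0 : 0 < Num.sqrt N by rewrite sqrtr_gt0.
  have l0 : 0 < l by rewrite invr_gt0.
  have lN : l ^+ 2 * N = 1 by rewrite /l exprVn sqr_sqrtr ?(ltW N0)// mulVf ?gt_eqF.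
  have cW : {within `[0, L], continuous (fun x => well (l * w x))}.
    apply: (@within_comp_cont _ _ _ _ (fun v => well (l * v))) => // v.
    apply: (@continuous_comp _ _ _ (fun v => l * v) well); last exact: continuous_well.
    exact: mulrl_continuous.
  have IW : Rint 0 L (fun x => well (l * w x)) <= 0.
    rewrite (@Rint_eq _ _ _ _ (fun x => l ^+ 2 / 2 * (w x ^+ 2 * ln (w x ^+ 2 / N)) +
        (- (l ^+ 2 / 2) * w x ^+ 2 + 2^-1))); last first.
      by move=> x _; rewrite /well (sqr_ln_split _ N0 l0) lN ln1 exprMn; field.
    rewrite RintD; [|exact: integZ|by apply: integD; [exact: integZ|exact: integ_cst]].
    rewrite RintZ// RintD; [|exact: integZ|exact: integ_cst].
    rewrite RintZ// -NE -[fun x => 2^-1]/(cst 2^-1) Rint_cst ?(ltW L0)// -entE subr0.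
    have -> : - (l ^+ 2 / 2) * (N * L) = - (l ^+ 2 * N) * L / 2 by field.
    rewrite lN.
    have : l ^+ 2 / 2 * entropy L w <= 0 by rewrite mulr_ge0_le0// divr_ge0// sqr_ge0.
    lra.
  move=> y yL; have well0' := cont_Rint_eq0 L0 cW (fun x _ => well_ge0 (l * w x)) IW yL.
  have {well0'} : well (l * `|w y|) = 0.
    by rewrite -[RHS]well0' /well !exprMn real_normK ?num_real.
  have lw0 : 0 <= l * `|w y| by rewrite mulr_ge0// ltW.
  have [v1|v1|v1] := ltgtP (l * `|w y|) 1.
  - by have := well_decr lw0 v1 (lexx _); rewrite well1 => /[swap] ->; rewrite ltxx.
  - by have := well_incr (lexx _) v1; rewrite well1 => /[swap] ->; rewrite ltxx.
  move=> _; rewrite -(real_normK (num_real (w y))).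
  have -> : `|w y| = Num.sqrt N by rewrite -[LHS]mul1r -(@mulfV _ (Num.sqrt N)) ?gt_eqF// -mulrA v1 mulr1.
  by rewrite sqr_sqrtr// ltW.
move=> x xL; have x0L : 0 <= (0 : R) <= L by apply/andP; split => //; exact: ltW.
have /andP[x0 xL'] := xL.
have : w x ^+ 2 = w 0 ^+ 2 by rewrite !w2.
(* Opposite values at 0 and x force a zero of [w] in between, hence N = 0 and [w 0 = 0]. *)
move=> /eqP; rewrite eqf_sqr => /orP[/eqP//|/eqP wx].
have cx : {within `[0, x], continuous w}.
  by apply: continuous_subspaceW cw; apply: subset_itvl; rewrite bnd_simp.
have [] := @IVT R w 0 x 0 x0 cx.
  rewrite wx ge_min le_max.
  by have [h|h] := leP 0 (w 0); rewrite ?oppr_le0 ?oppr_ge0 ?h ?(ltW h) ?orbT.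
move=> z; rewrite in_itv/= => /andP[z0 zx] wz.
have N0 : N = 0 by rewrite -(w2 z) ?wz ?expr0n//; lra.
have := w2 0 x0L; rewrite N0 => /eqP; rewrite sqrf_eq0 => /eqP w0.
by rewrite wx w0 oppr0.
Qed.

End linearization.

(** * The lower bound for every order *)

Section lower_bound.
Context {R : realType}.
Implicit Types (a b c d x y e s t L : R) (f g h w u v : R -> R) (k n : nat).
Local Notation mu := (@lebesgue_measure R).

Lemma weak_deriv1_continuous_rep L u v : 0 < L -> integ_on 0 L u ->
  is_weak_deriv L 1 u v -> exists w, [/\ {within `[0, L], continuous w},
    w 0 = w L, ae_eq_on 0 L u w &
    forall s t, 0 <= s -> s <= t -> t <= L ->
      `|w t - w s| <= Rint s t (fun x => `|v x|)].
Proof.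
move=> L0 ui uv; have [d ud] := weak_deriv1_primitive L0 ui uv.
have vi : integ_on 0 L v by case: uv => /circle_L1_integ.
exists (fun x => d + Rint 0 x v); split => //.
- move=> x; apply: cvgD; first exact: cvg_cst.
  exact: (Rint_continuous (ltW L0) vi).
- by rewrite Rintxx (weak_deriv1_mean0 uv).
- move=> s t s0 st tL; rewrite opprD addrACA subrr add0r Rint_sub//; last first.
    exact: integ_sub vi.
  by apply: le_norm_Rint; exact: integ_sub vi.
Qed.

(** The representative chosen by [weak_deriv] need not be the square-integrable witness in
    [sobolev]; uniqueness almost everywhere transfers the integrability. *)
Lemma sobolev_weak_deriv L n u k : 0 < L -> sobolev L n u -> (k <= n)%N ->
  is_weak_deriv L k u (weak_deriv L k u) /\
  integ_on 0 L (fun x => weak_deriv L k u x ^+ 2).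
Proof.
move=> L0 [_ uP] /uP[v uv /circle_L2_sqr v2].
have uw := weak_derivP uv; split => //.
have mw : measurable_fun `[0, L] (weak_deriv L k u).
  by case: uw => /circle_L1_integ /integ_measurable.
apply: integ_ae v2; first exact: measurable_funX.
by apply: ae_mono (weak_deriv_unique L0 uv uw) => x + xL => /(_ xL) ->.
Qed.

Lemma energyE L n u : energy L n u = Rint 0 L (fun x => weak_deriv L n u x ^+ 2).
Proof. by apply: Rint_eq => x _; rewrite real_normK ?num_real. Qed.

Lemma weak_poincare L u v : 0 < L -> integ_on 0 L u -> Rint 0 L u = 0 ->
  is_weak_deriv L 1 u v -> integ_on 0 L (fun x => v x ^+ 2) ->
  (2 * pi / L) ^+ 2 * Rint 0 L (fun x => u x ^+ 2) <= Rint 0 L (fun x => v x ^+ 2).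
Proof.
move=> L0 ui u0 uv v2.
have [w [cw w0L uw wv]] := weak_deriv1_continuous_rep L0 ui uv.
have vi : integ_on 0 L v by case: uv => /circle_L1_integ.
have mu_ := integ_measurable ui.
have mw := integ_measurable (integ_cont cw).
have -> : Rint 0 L (fun x => u x ^+ 2) = Rint 0 L (fun x => w x ^+ 2).
  apply: Rint_ae; [exact: measurable_funX|exact: measurable_funX|].
  by apply: ae_mono uw => x + xL => /(_ xL) ->.
have w0 : Rint 0 L w = 0 by rewrite -(Rint_ae mu_ mw uw).
have -> : Rint 0 L (fun x => v x ^+ 2) = Rint 0 L (fun x => `|v x| ^+ 2).
  by apply: Rint_eq => x _; rewrite real_normK ?num_real.
apply: poincare => //; first exact: integ_norm.
by apply: integ_eq v2 => x _; rewrite real_normK ?num_real.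
Qed.

(** The function itself need not have mean zero, but its weak derivatives do. The Poincare steps
    therefore start at order 1, and the two missing powers come from the logarithmic inequality. *)
Lemma energy_ge L n u : 0 < L -> sobolev L n u -> (0 < n)%N ->
  (2 * pi / L) ^+ (2 * n.-1) * energy L 1 u <= energy L n u.
Proof.
move=> L0 uS; case: n uS => // n uS _ /=.
have step k : (k <= n)%N -> (2 * pi / L) ^+ (2 * k) * energy L 1 u <= energy L k.+1 u.
  elim: k => [|k IH] kn; first by rewrite muln0 expr0 mul1r.
  have [d1 i1] := sobolev_weak_deriv L0 uS (leqW (ltnW kn)).
  have [d2 i2] := sobolev_weak_deriv L0 uS (k := k.+1) (leqW kn).
  have [d3 i3] := sobolev_weak_deriv L0 uS (k := k.+2) kn.
  have wi : integ_on 0 L (weak_deriv L k.+1 u) by case: d2 => /circle_L1_integ.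
  have m0 := weak_deriv1_mean0 (weak_derivS d1 d2).
  have := weak_poincare L0 wi m0 (weak_derivS d2 d3) i3.
  rewrite -!energyE; apply: le_trans.
  rewrite mulnS exprD -mulrA ler_wpM2l ?sqr_ge0//.
  by apply: IH; exact: ltnW.
exact: step.
Qed.

Lemma entropy_ae L u w : measurable_fun `[0, L] u -> measurable_fun `[0, L] w ->
  ae_eq_on 0 L u w -> entropy L u = entropy L w.
Proof.
move=> mu_ mw uw.
have N : circle_L2norm L u = circle_L2norm L w.
  congr (Num.sqrt (L^-1 * _)).
  apply: (@Rint_ae _ 0 L (fun x => u x ^+ 2) (fun x => w x ^+ 2)).
  - exact: measurable_funX.
  - exact: measurable_funX.
  - by apply: ae_mono uw => x + xL => /(_ xL) ->.
rewrite /entropy N; set c := circle_L2norm L w ^+ 2.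
have mc := continuous_measurable_fun (@continuous_sqr_ln R c).
apply: (@Rint_ae _ 0 L (fun x => u x ^+ 2 * ln (u x ^+ 2 / c)) (fun x => w x ^+ 2 * ln (w x ^+ 2 / c))).
- exact: (measurableT_comp mc mu_).
- exact: (measurableT_comp mc mw).
- by apply: ae_mono uw => x + xL => /(_ xL) ->.
Qed.

Lemma calH_ratio_ge L n u : 0 < L -> (0 < n)%N -> calH L n u ->
  2^-1 * (2 * pi / L) ^+ (2 * n) <= energy L n u / entropy L u.
Proof.
move=> L0 n0 [uS uN].
have [uLp _] := uS.
have ui := circle_L2_integ uLp.
have [uv v2] := sobolev_weak_deriv L0 uS n0.
have [w [cw w0L uw wv]] := weak_deriv1_continuous_rep L0 ui uv.
set v := weak_deriv L 1 u in uN uv v2 wv.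
have vi : integ_on 0 L v by case: uv => /circle_L1_integ.
have mu_ := integ_measurable ui.
have mw := integ_measurable (integ_cont cw).
have entE := entropy_ae mu_ mw uw.
(* Positivity must come first: with a zero denominator the quotient would be 0, below the bound.
   Nonpositive entropy would make [u] constant almost everywhere and its weak derivative null,
   against membership in [calH]. *)
have ent0 : 0 < entropy L u.
  rewrite ltNge; apply/negP => ent; apply: uN.
  rewrite entE in ent; have wc := entropy_le0_cst L0 cw ent.
  have uc : ae_eq_on 0 L u (cst (w 0)).
    by apply: ae_mono uw => x + xL => /(_ xL) ->; exact: wc.
  apply: ae_mono (weak_deriv1_cst L0 mu_ uc uv) => x + xL.
  by rewrite in_itv/= in xL => /(_ xL).
rewrite (ler_pdivlMr _ _ ent0).
have ls : (2 * pi / L) ^+ 2 / 2 * entropy L u <= energy L 1 u.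
  rewrite entE energyE -/v.
  have -> : Rint 0 L (fun x => v x ^+ 2) = Rint 0 L (fun x => `|v x| ^+ 2).
    by apply: Rint_eq => x _; rewrite real_normK ?num_real.
  apply: (log_sobolev L0 cw w0L (integ_norm vi) _ (fun x => normr_ge0 (v x)) wv).
  by apply: integ_eq v2 => x _; rewrite real_normK ?num_real.
move: ls (energy_ge L0 uS n0); move: (energy L n u) (energy L 1 u) (entropy L u).
clear -n0 => En E1 S ls; apply: le_trans.
have -> : (2 * pi / L) ^+ (2 * n) = (2 * pi / L) ^+ (2 * n.-1) * (2 * pi / L) ^+ 2.
  by rewrite -exprD addnC -mulnS prednK.
have := ler_wpM2l (exprn_ge0 n.-1 (sqr_ge0 (2 * pi / L))) ls.
by rewrite -exprM; lra.
Qed.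

End lower_bound.

(** * Cosine perturbations of the constant 1 *)

Section upper_bound.
Context {R : realType}.
Context (L : R) (L0 : 0 < L).
Implicit Types (a b c d x y e s t : R) (f g h w u v : R -> R) (k n : nat).
Local Notation mu := (@lebesgue_measure R).

Let om := 2 * pi / L.

(** The phase [b] keeps the family closed under differentiation, which advances it by a quarter
    turn. *)
Definition wave e b x := e * cos (om * x + b).

Lemma om_gt0 : 0 < om. Proof. by rewrite divr_gt0 ?mulr_gt0 ?pi_gt0. Qed.

Lemma omL : om * L = 2 * pi. Proof. by rewrite divfK// gt_eqF. Qed.

Lemma is_derive_wave e b x : is_derive x 1 (wave e b) (wave (e * om) (b + pi / 2) x).
Proof.
have h := is_deriveZ e (is_derive1_comp (is_derive_cos _) (is_derive_affine om b x)).
apply: is_derive1_eq h.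
by rewrite /wave /GRing.scale/= addrA cosDpihalf; ring.
Qed.

Lemma wave_test e b c : circle_test L (fun x => c + wave e b x).
Proof.
split.
  move=> x; rewrite /wave; congr (_ + _ * _).
  by rewrite mulrDr omL addrAC [2 * pi]mulr_natl cosD2pi.
apply: elementary_smooth; apply: elem_add; first exact: elem_cst.
by apply: elem_mul; [exact: elem_cst|exact: elem_cos].
Qed.

Lemma derive1n_wave e k : exists b,
  derive1n k.+1 (fun x => 1 + wave e 0 x) = wave (e * om ^+ k.+1) b.
Proof.
elim: k => [|k [b IH]].
  exists (0 + pi / 2); rewrite expr1; apply/funext => x.
  rewrite /= derive1E.
  have h : is_derive x 1 (fun x => 1 + wave e 0 x) (wave (e * om) (0 + pi / 2) x).
    by apply: is_derive1_eq (is_deriveD (is_derive_cst (1 : R) x 1) (is_derive_wave e 0 x)); rewrite add0r.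
  by have [_ ->] := h.
exists (b + pi / 2); rewrite derive1nS IH; apply/funext => x.
by rewrite derive1E; have [_ ->] := is_derive_wave (e * om ^+ k.+1) b x; rewrite [in RHS]exprSr mulrA.
Qed.

Lemma wave_period e b : wave e b L = wave e b 0.
Proof. by have := (wave_test e b 0).1 0; rewrite /= !add0r. Qed.

Lemma continuous_wave e b : continuous (wave e b).
Proof. by apply: (@is_derive_continuous _ _ (wave (e * om) (b + pi / 2))) => x; exact: is_derive_wave. Qed.

Lemma Rint_wave e b : Rint 0 L (wave e b) = 0.
Proof.
have FP x : is_derive x 1 (wave (e / om) (b - pi / 2)) (wave e b x).
  apply: is_derive1_eq (is_derive_wave (e / om) (b - pi / 2) x).
  by rewrite divfK ?gt_eqF ?om_gt0// subrK.
rewrite (Rint_is_derive (ltW L0) _ FP) ?wave_period ?subrr//; exact: continuous_wave.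
Qed.

(** The double-angle formula provides an explicit primitive. The value does not depend on the phase,
    so the one left unspecified by [derive1n_wave] is harmless. *)
Lemma Rint_wave_sqr e b : Rint 0 L (fun x => wave e b x ^+ 2) = e ^+ 2 * (L / 2).
Proof.
have E x : wave e b x ^+ 2 = e ^+ 2 / 2 + wave (e ^+ 2 / 2) (2 * b) (2 * x).
  rewrite /wave.
  have -> : om * (2 * x) + 2 * b = (om * x + b) + (om * x + b) by ring.
  rewrite (cosD (om * x + b)); have := cos2Dsin2 (om * x + b).
  set C := cos _; set S := sin _; move=> CS.
  have -> : S * S = 1 - C ^+ 2 by rewrite -CS; ring.
  by field.
have FP x : is_derive x 1 (fun x => (e ^+ 2 / 2) * x + e ^+ 2 / (4 * om) * cos (2 * om * x + (2 * b - pi / 2)))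
    (wave e b x ^+ 2).
  have h := is_deriveD (is_derive_affine (e ^+ 2 / 2) 0 x)
    (is_deriveZ (e ^+ 2 / (4 * om)) (is_derive1_comp (is_derive_cos _) (is_derive_affine (2 * om) (2 * b - pi / 2) x))).
  have {}h : is_derive x 1 (fun x => (e ^+ 2 / 2 * x + 0) + e ^+ 2 / (4 * om) * cos (2 * om * x + (2 * b - pi / 2))) _ := h.
  under eq_fun do rewrite -[e ^+ 2 / 2 * _]addr0.
  apply: is_derive1_eq h.
  rewrite E /wave /GRing.scale/=.
  have -> : 2 * om * x + (2 * b - pi / 2) = om * (2 * x) + 2 * b - pi / 2 by ring.
  have := cosDpihalf (om * (2 * x) + 2 * b - pi / 2); rewrite subrK => ->.
  by field; rewrite gt_eqF ?om_gt0.
rewrite (Rint_is_derive (ltW L0) _ FP).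
  have -> : 2 * om * L + (2 * b - pi / 2) = (2 * b - pi / 2) + pi *+ 2 + pi *+ 2.
    by rewrite -mulrA omL; ring.
  rewrite !cosD2pi (_ : 2 * om * 0 + (2 * b - pi / 2) = 2 * b - pi / 2).
    by field; rewrite gt_eqF ?om_gt0.
  by rewrite mulr0 add0r.
exact: (contM (@continuous_wave e b) (@continuous_wave e b)).
Qed.

Let perturb e x := 1 + wave e 0 x.

Lemma weak_deriv_wave e k :
  Rint 0 L (fun x => weak_deriv L k.+1 (perturb e) x ^+ 2) = e ^+ 2 * om ^+ (2 * k.+1) * (L / 2).
Proof.
have tw := wave_test e 0 1.
have wd := test_weak_deriv k.+1 L0 tw.
have wd' := weak_derivP wd.
have ae := weak_deriv_unique L0 wd' wd.
have [b bE] := derive1n_wave e k.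
transitivity (Rint 0 L (fun x => derive1n k.+1 (perturb e) x ^+ 2)).
  apply: Rint_ae.
  - by apply: measurable_funX; case: wd' => /circle_L1_integ /integ_measurable.
  - by apply: measurable_funX; case: wd => /circle_L1_integ /integ_measurable.
  - by apply: ae_mono ae => x + xL => /(_ xL) ->.
by rewrite /perturb bE Rint_wave_sqr exprMn -exprM mulnC.
Qed.

Lemma perturb_calH e n : 0 < e -> calH L n (perturb e).
Proof.
move=> e0; have tw := wave_test e 0 1.
split.
  split; first exact: test_circle_Lp.
  move=> k _; exists (derive1n k (perturb e)); first exact: test_weak_deriv.
  by apply: test_circle_Lp; exact: test_derive1n.
move=> ae0; have := weak_deriv_wave e 0.
have mw : measurable_fun `[0, L] (weak_deriv L 1 (perturb e)).
  have [/circle_L1_integ /integ_measurable //] := weak_derivP (test_weak_deriv 1 L0 tw).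
rewrite (@Rint_ae _ _ _ _ (cst 0)) ?Rint_cst ?(ltW L0)//.
- rewrite mul0r => /esym/eqP; rewrite gt_eqF//.
  by rewrite mulr_gt0 ?divr_gt0// mulr_gt0// exprn_gt0// om_gt0.
- exact: measurable_funX.
- apply: ae_mono ae0 => x + xL; rewrite in_itv/= xL => /(_ isT) ->.
  by rewrite expr0n.
Qed.

(** The energy is exactly e^2 om^(2 n) L / 2, while the entropy is at least e^2 L (1 - 3 e), the
    cosine being bounded by 1. *)
Lemma perturb_ratio_le e n : 0 < e -> 3 * e < 1 -> (0 < n)%N ->
  energy L n (perturb e) / entropy L (perturb e) <=
  2^-1 * om ^+ (2 * n) / (1 - 3 * e).
Proof.
move=> e0 e3; case: n => // n _.
rewrite energyE weak_deriv_wave.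
have cB x : 0 <= x <= L -> `|wave 1 0 x| <= 1.
  by move=> _; rewrite /wave mul1r ler_norml cos_geN1 cos_le1.
have e2 : e * 1 < 2^-1 by lra.
have := entropy_expansion L0 (within_cont (@continuous_wave 1 0)) cB e0 e2 (Rint_wave 1 0).
rewrite Rint_wave_sqr expr1n mul1r mulr1.
have -> : (fun x => 1 + e * wave 1 0 x) = perturb e.
  by apply/funext => x; rewrite /perturb /wave mul1r.
have -> : 2 * e ^+ 2 * (L / 2) * (1 - 3 * e) = e ^+ 2 * L * (1 - 3 * e) by field.
have e13 : 0 < 1 - 3 * e by lra.
have P0 : 0 < e ^+ 2 * L * (1 - 3 * e) by rewrite !mulr_gt0// exprn_gt0.
move=> entP; have ent0 := lt_le_trans P0 entP.
rewrite ler_pdivrMr//.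
have O0 : 0 <= 2^-1 * om ^+ (2 * n.+1) / (1 - 3 * e).
  by rewrite divr_ge0 ?(ltW e13)// mulr_ge0// exprn_ge0// ltW// om_gt0.
apply: le_trans (ler_wpM2l O0 entP).
rewrite le_eqVlt; apply/orP; left; apply/eqP; field.
by rewrite gt_eqF.
Qed.

End upper_bound.

(** * The infimum *)

Theorem corollary8 (R : realType) (L : R) (L_gt0 : 0 < L) (n : nat)
    (n_gt0 : (0 < n)%N) :
  ereal_inf [set (energy L n u / entropy L u)%:E | u in calH L n] =
  (2^-1 * (2 * pi / L) ^+ (2 * n))%:E.
Proof.
apply/eqP; rewrite eq_le; apply/andP; split; last first.
  by apply/ereal_infP => _ [u uH <-]; rewrite lee_fin calH_ratio_ge.
set c := 2^-1 * _.
have c0 : 0 < c.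
  by rewrite mulr_gt0// exprn_gt0// divr_gt0// mulr_gt0// pi_gt0.
apply/lee_addgt0Pr => d d0; rewrite -EFinD.
have cd0 : 0 < c + d by rewrite addr_gt0.
(* Chosen so that 1 - 3 e = c / (c + d), which turns the bound c / (1 - 3 e) on the ratio into c +
   d. *)
pose e := d / (c + d) / 3.
have e0 : 0 < e by rewrite !divr_gt0.
have e3 : 1 - 3 * e = c / (c + d) by rewrite /e; field; rewrite gt_eqF.
have e31 : 3 * e < 1 by rewrite -subr_gt0 e3 divr_gt0.
apply: ge_ereal_inf; eexists; first by exists (fun x => 1 + wave L e 0 x) => //; exact: perturb_calH.
rewrite lee_fin; apply: le_trans (perturb_ratio_le L_gt0 e0 e31 n_gt0) _.
rewrite e3 -/c le_eqVlt; apply/orP; left; apply/eqP; field.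
by rewrite !gt_eqF.
Qed.
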